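(* Let $\Omega=\{(a_1,a_2,a_3)\in\mathbb{R}^3 \mid Q(a_1,a_2,a_3)=0\}$, where $Q$ is the symmetric polynomial of degree $12$ given in the context. With respect to the standard topology of $\mathbb{R}^3$: (1) the set $(0,1/2]^3\cap\Omega$ is connected; (2) the set $(0,1/2]^3\setminus\Omega$ consists of three connected components (i.e. it has exactly three connected components).
   Context: For $(a_1,a_2,a_3)\in\mathbb{R}^3$ put $s_1=a_1+a_2+a_3$, $s_2=a_1a_2+a_1a_3+a_2a_3$, $s_3=a_1a_2a_3$, and define $$\begin{aligned}Q(a_1,a_2,a_3)={}&(2s_1+4s_3-1)\bigl(64s_1^5-64s_1^4+8s_1^3+12s_1^2-6s_1+1\\&\quad+240s_3s_1^2-240s_3s_1-1536s_3^2s_1-4096s_3^3+60s_3+768s_3^2\bigr)\\&-8s_1(2s_1+4s_3-1)(2s_1-32s_3-1)(10s_1+32s_3-5)s_2\\&-16s_1^2(13-52s_1+640s_3s_1+1024s_3^2-320s_3+52s_1^2)s_2^2\\&+64(2s_1-1)(2s_1-32s_3-1)s_2^3+2048s_1(2s_1-1)s_2^4.\end{aligned}$$ Here $(0,1/2]^3$ denotes the half-open cube $\{(a_1,a_2,a_3) : 0<a_i\le 1/2,\ i=1,2,3\}$. *)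

(* Defs.v *)
From HB Require Import structures.
From mathcomp Require Import all_boot all_order all_algebra.
From mathcomp Require Import all_classical all_reals all_analysis.
Import Order.TTheory GRing.Theory Num.Theory.
Import numFieldNormedType.Exports.

Set Implicit Arguments.
Unset Strict Implicit.
Unset Printing Implicit Defensive.

Local Open Scope classical_set_scope.
Local Open Scope ring_scope.

Section WallachSurface.
Variable R : realType.
Implicit Types a : 'rV[R]_3.

Definition s1 a : R := a 0 0 + a 0 1 + a 0 2.

Definition s2 a : R := a 0 0 * a 0 1 + a 0 0 * a 0 2 + a 0 1 * a 0 2.

Definition s3 a : R := a 0 0 * a 0 1 * a 0 2.

(* The polynomial as a function of the elementary symmetric functions. *)
Definition Q_sym (s1 s2 s3 : R) : R :=
    (2 * s1 + 4 * s3 - 1)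
      * (64 * s1 ^+ 5 - 64 * s1 ^+ 4 + 8 * s1 ^+ 3 + 12 * s1 ^+ 2 - 6 * s1 + 1
         + 240 * s3 * s1 ^+ 2 - 240 * s3 * s1 - 1536 * s3 ^+ 2 * s1
         - 4096 * s3 ^+ 3 + 60 * s3 + 768 * s3 ^+ 2)
  - 8 * s1 * (2 * s1 + 4 * s3 - 1) * (2 * s1 - 32 * s3 - 1)
      * (10 * s1 + 32 * s3 - 5) * s2
  - 16 * s1 ^+ 2
      * (13 - 52 * s1 + 640 * s3 * s1 + 1024 * s3 ^+ 2 - 320 * s3
         + 52 * s1 ^+ 2) * s2 ^+ 2
  + 64 * (2 * s1 - 1) * (2 * s1 - 32 * s3 - 1) * s2 ^+ 3
  + 2048 * s1 * (2 * s1 - 1) * s2 ^+ 4.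

Definition Q a : R := Q_sym (s1 a) (s2 a) (s3 a).

Definition Omega : set 'rV[R]_3 := [set a | Q a = 0].

Definition cube : set 'rV[R]_3 := [set a | forall i, 0 < a 0 i <= 1 / 2].

End WallachSurface.

Arguments Omega : clear implicits.
Arguments cube : clear implicits.

(* Only base points in [A] are used: outside [A] the library's
   [connected_component A x] is [set0]. *)
Definition connected_components (T : topologicalType) (A : set T) :
    set (set T) :=
  connected_component A @` A.

(* Main.v *)
From HB Require Import structures.
Require Import Defs.
From mathcomp Require Import all_boot all_order all_algebra.
From mathcomp Require Import all_classical all_reals all_analysis.
From mathcomp Require Import ring lra.
Import Order.TTheory GRing.Theory Num.Theory.
Import numFieldNormedType.Exports.

(** [Q] is [-256] times the discriminant of a binary cubic form.  With
[t1 + t2 + t3 = 0], [k = (2 s1 - 1) / 4] and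
[A_i = 2 t_i a_i - (t1 a1 + t2 a2 + t3 a3)], that form is
[A_1 A_2 A_3 - k t1 t2 t3], the determinant of a pencil of conics.
By symmetry let [a1 >= a2 >= a3].  Putting [t = (-X, -1, 1 + X)] gives a cubic
[pencil X] which, when [a2 > a3], has a root in [-1, 0) and never has three
negative roots; so [Q < 0] iff [pencil X > 0] for some [X > 0].  Fixing [X] turns
the geometry into one-variable monotonicity:

- along a ray from the origin, [pencil X] can only leave the positive half line
  while [s1 <= 3/4] and can only return to it once [s1 >= 3/4];
- on the plane [s1 = 3/4], AM-GM gives [Q > 0] except at the centre (1/4,1/4,1/4);
- where [s1 >= 3/4], raising the smallest coordinate keeps [pencil X] positive.

Hence the part of [Omega] with [s1 <= 3/4] is a graph over the open simplex of
directions, the part with [s1 >= 3/4] and [a1 >= a2 >= a3] is a graph of [a3] over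
a connected set of pairs [(a1, a2)], and both contain the centre.  The components
of the complement are [Q < 0] with [s1 < 3/4], [Q < 0] with [s1 > 3/4], and
[Q > 0]; explicit segments and rays show that each of them is connected. *)

Set Implicit Arguments.
Unset Strict Implicit.
Unset Printing Implicit Defensive.

Local Open Scope classical_set_scope.
Local Open Scope ring_scope.

(** * Q as a discriminant *)

Section Cubic.
Variable R : realType.
Implicit Types a b c X : R.

Definition Qc a b c : R :=
  Q_sym (a + b + c) (a * b + a * c + b * c) (a * b * c).

Definition kappa a b c : R := (2 * (a + b + c) - 1) / 4.

(** At [t = (-X, -1, 1 + X)] the three linear factors are [-A_2], [-A_1], [A_3], and
    [t1 t2 t3 = X (1 + X)]. *)
Definition pencil a b c X : R :=
  ((c + b) - (a - c) * X) * ((c + a) * X - (b - c)) * ((c + b) + (c + a) * X)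
  - kappa a b c * X * (1 + X).

Definition disc (u v w z : R) : R :=
  v ^+ 2 * w ^+ 2 - 4 * u * w ^+ 3 - 4 * v ^+ 3 * z - 27 * u ^+ 2 * z ^+ 2
  + 18 * u * v * w * z.

Definition pencil_coef2 a b c : R :=
  (c + a) * ((c + b) * (c + a) - 2 * c * (a - c)) - kappa a b c.

Definition pencil_coef1 a b c : R :=
  (c + b) * (2 * c * (c + a) + (a - c) * (b - c)) - kappa a b c.

(** Up to sign, what the pencil takes where some [t_i] vanishes: its values at [X = 0] and [X = -1],
    and its leading coefficient for [X] at infinity. *)
Definition edge a c : R := (a - c) * (a + c) ^+ 2.

Lemma pencil_expand a b c X :
  pencil a b c X = - edge a c * X ^+ 3 + pencil_coef2 a b c * X ^+ 2
    + pencil_coef1 a b c * X - edge b c.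
Proof. by rewrite /pencil /pencil_coef1 /pencil_coef2 /edge /kappa; field. Qed.

Lemma Qc_disc a b c :
  Qc a b c = - 256 *
    disc (- edge a c) (pencil_coef2 a b c) (pencil_coef1 a b c) (- edge b c).
Proof. by rewrite /Qc /Q_sym /disc /pencil_coef1 /pencil_coef2 /edge /kappa; field. Qed.

Lemma diag_ge0 b : 0 <= b -> 0 <= 32 * b ^+ 3 - 6 * b + 1.
Proof.
move=> b0; have -> : 32 * b ^+ 3 - 6 * b + 1 = (4 * b - 1) ^+ 2 * (2 * b + 1).
  by ring.
by rewrite mulr_ge0 ?sqr_ge0//; lra.
Qed.

Lemma wall_gt0 b : 0 <= b -> 0 < 16 * b ^+ 3 - 4 * b + 1.
Proof.
(* The minimum over [b >= 0] is at [1 / sqrt 12]; 3/10 is a rational point nearby, and the affine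
   remainder is the tangent line there. *)
move=> b0; have -> : 16 * b ^+ 3 - 4 * b + 1 =
  16 * ((b - 3 / 10) ^+ 2 * (b + 3 / 5)) + (8 / 25 * b + 17 / 125).
  by field.
suff : 0 <= (b - 3 / 10) ^+ 2 * (b + 3 / 5) by lra.
by rewrite mulr_ge0 ?sqr_ge0//; lra.
Qed.

(** The difference of the two sides is affine in [c]; its values at [c = 0] and [c = b] are the
    polynomials of [wall_gt0] and [diag_ge0]. *)
Lemma wall_poly_gt b c : 0 <= c < b ->
  2 * (b + b + c) - 1 < 16 * b ^+ 2 * (b + c).
Proof.
move=> /andP[c0 cb]; have b0 : 0 < b by lra.
have v0 : 0 < (b - c) * (16 * b ^+ 3 - 4 * b + 1).
  by rewrite mulr_gt0 ?wall_gt0//; lra.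
have v1 : 0 <= c * (32 * b ^+ 3 - 6 * b + 1).
  by rewrite mulr_ge0 ?diag_ge0//; lra.
rewrite -subr_gt0 -(pmulr_rgt0 _ b0).
suff -> : b * (16 * b ^+ 2 * (b + c) - (2 * (b + b + c) - 1)) =
  (b - c) * (16 * b ^+ 3 - 4 * b + 1) + c * (32 * b ^+ 3 - 6 * b + 1) by lra.
by ring.
Qed.

(** Four times a middle coefficient of the pencil expanded at -1 in the variable [Y = -1 - X]. *)
Definition outer a b c : R :=
  4 * (a + b) * (3 * a ^+ 2 + a * c + b * c - a * b) - (2 * (a + b + c) - 1).

Lemma pencil_outer a b c Y : pencil a b c (- 1 - Y) =
  edge a c * Y ^+ 3 + outer a c b / 4 * Y ^+ 2 + outer a b c / 4 * Y + edge a b.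
Proof. by rewrite /pencil /edge /outer /kappa; field. Qed.

(** Interpolates in [b] between the values at [b = 0] and [b = a]; the term [4 a^2 b (a - b)] is the
    correction for concavity in [b]. *)
Lemma outer_0_gt0 a b : 0 < a -> 0 <= b <= a -> 0 < outer a b 0.
Proof.
move=> a0 /andP[b0 ba]; rewrite -(pmulr_rgt0 _ a0).
have -> : a * outer a b 0 = (a - b) * (12 * a ^+ 3 - 2 * a + 1)
    + b * (16 * a ^+ 3 - 4 * a + 1) + 4 * a ^+ 2 * b * (a - b).
  by rewrite /outer; ring.
have w := wall_gt0 (ltW a0).
have a3 : 0 < a ^+ 3 by rewrite exprn_gt0.
have v0 : 0 <= b * (16 * a ^+ 3 - 4 * a + 1) by rewrite mulr_ge0// ltW.
have v1 : 0 <= 4 * a ^+ 2 * b * (a - b) by rewrite !mulr_ge0 ?sqr_ge0//; lra.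
have v2 : 0 <= (a - b) * (12 * a ^+ 3 - 2 * a + 1) by rewrite mulr_ge0//; lra.
have [->|nba] := eqVneq b a; first nra.
suff : 0 < (a - b) * (12 * a ^+ 3 - 2 * a + 1) by lra.
by rewrite mulr_gt0//; [rewrite subr_gt0 lt_neqAle nba|lra].
Qed.

Lemma outer_diag_ge0 a b : 0 < a -> 0 <= b <= a -> 0 <= outer a b a.
Proof.
move=> a0 /andP[b0 ba]; rewrite -(pmulr_rge0 _ a0).
have -> : a * outer a b a = (a - b) * (16 * a ^+ 3 - 4 * a + 1)
    + b * (32 * a ^+ 3 - 6 * a + 1).
  by rewrite /outer; ring.
have w := wall_gt0 (ltW a0); have d := diag_ge0 (ltW a0).
by rewrite addr_ge0// mulr_ge0//; lra.
Qed.

Lemma outer_affine a b c :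
  a * outer a b c = (a - c) * outer a b 0 + c * outer a b a.
Proof. by rewrite /outer; ring. Qed.

Lemma outer_ge0 a b c : 0 < a -> 0 <= b <= a -> 0 <= c <= a ->
  0 <= outer a b c.
Proof.
move=> a0 ba /andP[c0 ca]; rewrite -(pmulr_rge0 _ a0) outer_affine.
have v0 := outer_0_gt0 a0 ba; have v1 := outer_diag_ge0 a0 ba.
by rewrite addr_ge0// mulr_ge0//; lra.
Qed.

Lemma outer_gt0 a b c : 0 < a -> 0 <= b <= a -> 0 <= c < a ->
  0 < outer a b c.
Proof.
move=> a0 ba /andP[c0 ca]; rewrite -(pmulr_rgt0 _ a0) outer_affine.
have v0 := outer_0_gt0 a0 ba; have v1 := outer_diag_ge0 a0 ba.
by rewrite ltr_wpDr ?mulr_ge0 ?mulr_gt0//; lra.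
Qed.

Lemma edge_ge0 a c : c <= a -> 0 <= edge a c.
Proof. by move=> ca; rewrite /edge mulr_ge0 ?sqr_ge0// subr_ge0. Qed.

Lemma edge_gt0 a c : 0 <= c < a -> 0 < edge a c.
Proof.
by move=> /andP[c0 ca]; rewrite /edge mulr_gt0 ?subr_gt0// exprn_gt0//; lra.
Qed.

(** In [Y = -1 - X > 0] all coefficients are nonnegative and the linear one is positive. Negative
    roots are thereby confined to [-1, 0). *)
Lemma pencil_lt_m1_gt0 a b c X : 0 <= c < b -> b <= a -> X < -1 -> 0 < pencil a b c X.
Proof.
move=> /andP[c0 cb] ba Xm; pose Y := - 1 - X.
have Y0 : 0 < Y by rewrite /Y; lra.
have -> : X = - 1 - Y by rewrite /Y; ring.
rewrite pencil_outer.
have a0 : 0 < a by lra.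
have e1 : 0 <= edge a c * Y ^+ 3.
  by rewrite mulr_ge0 ?edge_ge0 ?exprn_ge0 ?ltW//; lra.
have e2 : 0 <= outer a c b / 4 * Y ^+ 2.
  rewrite mulr_ge0 ?sqr_ge0//; apply: divr_ge0; last lra.
  by apply: outer_ge0 => //; apply/andP; split; lra.
have e3 : 0 < outer a b c / 4 * Y.
  rewrite mulr_gt0//; apply: divr_gt0; last lra.
  by apply: outer_gt0 => //; apply/andP; split; lra.
have := edge_ge0 ba; lra.
Qed.

Lemma pencil0 a b c : pencil a b c 0 = - edge b c.
Proof. by rewrite /pencil /edge; ring. Qed.

Lemma pencil_m1 a b c : pencil a b c (-1) = edge a b.
Proof. by rewrite /pencil /edge; ring. Qed.

Lemma edge_triple a b c : edge a b + edge b c - edge a c = (a - b) * (b - c) * (a - c).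
Proof. by rewrite /edge; ring. Qed.

(* All roots [- n] would lie in [-1, 0), so [edge_triple] gives
   [n1 n2 n3 + (1 - n1) (1 - n2) (1 - n3) >= 1], forcing [n1 = n2 = n3 = 1]. *)
Lemma pencil_roots_not_all_neg a b c (n1 n2 n3 : R) : 0 <= c < b -> b <= a ->
  0 < n1 -> 0 < n2 -> 0 < n3 ->
  ~ (forall X, pencil a b c X = - edge a c * (X + n1) * (X + n2) * (X + n3)).
Proof.
move=> cb ba n10 n20 n30 De.
have le1 (n : R) : pencil a b c (- n) = 0 -> n <= 1.
  move=> Dn; rewrite leNgt; apply/negP => gt1.
  have : 0 < pencil a b c (- n) by apply: pencil_lt_m1_gt0 => //; lra.
  by rewrite Dn ltxx.
have {le1} [n11 n21 n31] : [/\ n1 <= 1, n2 <= 1 & n3 <= 1].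
  by split; apply: le1; rewrite De; ring.
case/andP: (cb) => c0 cb'.
have Eac : 0 < edge a c by apply: edge_gt0; apply/andP; split; lra.
have EJ : edge a b = edge a c * ((1 - n1) * (1 - n2) * (1 - n3)).
  by rewrite -(pencil_m1 a b c) De; ring.
have EH : edge b c = edge a c * (n1 * n2 * n3).
  by apply: oppr_inj; rewrite -(pencil0 a) De; ring.
have le1 : 1 <= n1 * n2 * n3 + (1 - n1) * (1 - n2) * (1 - n3).
  rewrite -subr_ge0 -(pmulr_rge0 _ Eac).
  suff -> : edge a c * (n1 * n2 * n3 + (1 - n1) * (1 - n2) * (1 - n3) - 1) =
    edge a b + edge b c - edge a c.
    by rewrite edge_triple; apply: mulr_ge0; [apply: mulr_ge0|]; lra.
  by rewrite EJ EH; ring.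
(* Since [(1 - y) (1 - z) <= 1], the last hypothesis yields [x <= x y z], so [y z >= 1]. *)
have eq1 (x y z : R) : 0 < x -> x <= 1 -> 0 < y -> y <= 1 -> 0 < z -> z <= 1 ->
    1 <= x * y * z + (1 - x) * (1 - y) * (1 - z) -> y = 1.
  move=> x0 x1 y0 y1 z0 z1 xyz.
  have yz : 1 <= y * z.
    have h : (1 - x) * ((1 - y) * (1 - z)) <= (1 - x) * 1.
      by apply: ler_wpM2l; [lra|nra].
    rewrite -(ler_pM2l x0); nra.
  by apply/le_anti/andP; split => //; nra.
have n2e : n2 = 1 by apply: (eq1 n1 n2 n3).
have n3e : n3 = 1 by apply: (eq1 n1 n3 n2) => //; nra.
have n1e : n1 = 1 by apply: (eq1 n2 n1 n3) => //; nra.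
have ab : a = b.
  have : edge a b = 0 by rewrite EJ n1e; ring.
  rewrite /edge => /eqP; rewrite mulf_eq0 sqrf_eq0 => /orP[] /eqP; lra.
(* With [a = b], the factorisation at [X = 1] would turn the strict inequality [wall_poly_gt] into
   an equality. *)
have := De 1; rewrite n1e n2e n3e ab /pencil /edge /kappa => D1e.
have := wall_poly_gt cb.
suff : 2 * (b + b + c) - 1 = 16 * b ^+ 2 * (b + c) by lra.
nra.
Qed.
End Cubic.

(** * The sign of Q read off the pencil on [X > 0] *)

Section Sign.
Variable R : realType.
Implicit Types a b c X : R.

(** The pencil is nonnegative at -1 and negative at 0, which gives a root [-n] between. After
    division by [X + n], the discriminant of the cubic is that of the quadratic factor times their
    squared resultant. *)
Lemma pencil_factor a b c : 0 <= c < b -> b <= a ->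
  exists n q1 q0 : R, [/\ 0 < n, 0 < q0,
    forall X, pencil a b c X = - ((X + n) * (edge a c * X ^+ 2 + q1 * X + q0)) &
    Qc a b c = - 256 * ((q1 ^+ 2 - 4 * edge a c * q0) *
                        (edge a c * n ^+ 2 - q1 * n + q0) ^+ 2)].
Proof.
move=> cb ba; case/andP: (cb) => c0 cb'.
pose p : {poly R} := edge a c *: 'X^3 - pencil_coef2 a b c *: 'X^2
  - pencil_coef1 a b c *: 'X + (edge b c)%:P.
have pD X : p.[X] = - pencil a b c X.
  rewrite pencil_expand /p.
  by rewrite !(hornerD, hornerN, hornerZ, hornerXn, hornerX, hornerC); ring.
have H0 : 0 < edge b c by apply: edge_gt0.
have [||r /andP[r1 r0]] := @poly_ivt _ p (-1) 0; first by lra.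
  by rewrite !pD pencil_m1 pencil0; have := edge_ge0 ba; lra.
rewrite rootE pD oppr_eq0 => /eqP Dr.
have rn0 : r != 0.
  by apply/eqP => r0'; move: Dr; rewrite r0' pencil0 => /eqP; rewrite oppr_eq0 gt_eqF.
have rlt0 : r < 0 by rewrite lt_neqAle rn0.
pose n := - r; have n0 : 0 < n by rewrite /n; lra.
have nn0 : n != 0 by rewrite gt_eqF.
pose q0 := edge b c / n; pose q1 := - pencil_coef2 a b c - n * edge a c.
have q0e : edge b c = n * q0 by rewrite /q0; field.
have D2e : pencil_coef2 a b c = - (q1 + n * edge a c) by rewrite /q1; ring.
have D1e : pencil_coef1 a b c = - (q0 + n * q1).
  have : n * (pencil_coef1 a b c + (q0 + n * q1)) = 0.
    rewrite -{1}(opprK n) /= -[X in _ = X]oppr0 -Dr pencil_expand q0e D2e /n; ring.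
  move=> /eqP; rewrite mulf_eq0 (negPf nn0) => /eqP; lra.
exists n, q1, q0; split => //.
- by rewrite /q0 divr_gt0.
- by move=> X; rewrite pencil_expand D2e D1e q0e; ring.
- by rewrite Qc_disc /disc D2e D1e q0e; ring.
Qed.

(** The quadratic factor has positive outer coefficients, so real roots together with [q1 > 0] would
    make all three roots of the pencil negative; [q1 = 0] leaves no real root. *)
Lemma quadratic_root_neg a b c n (q1 q0 : R) : 0 <= c < b -> b <= a ->
  0 < n -> 0 < q0 ->
  (forall X, pencil a b c X = - ((X + n) * (edge a c * X ^+ 2 + q1 * X + q0))) ->
  4 * edge a c * q0 <= q1 ^+ 2 -> q1 < 0.
Proof.
move=> cb ba n0 q00 De dle; case/andP: (cb) => c0 cb'.
have E0 : 0 < edge a c by apply: edge_gt0; apply/andP; split; lra.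
have Eq0 : 0 < edge a c * q0 by rewrite mulr_gt0.
rewrite ltNge le_eqVlt; apply/negP => /orP[/eqP q1e|q1p].
  by move: dle; rewrite -q1e; nra.
pose s := Num.sqrt (q1 ^+ 2 - 4 * edge a c * q0).
have s2 : s ^+ 2 = q1 ^+ 2 - 4 * edge a c * q0 by rewrite sqr_sqrtr// subr_ge0.
have s0 : 0 <= s by rewrite sqrtr_ge0.
have sq : s < q1.
  rewrite ltNge; apply/negP => qs.
  by have := ler_pM (ltW q1p) (ltW q1p) qs qs; rewrite -!expr2 s2; lra.
apply: (@pencil_roots_not_all_neg _ a b c n ((q1 - s) / (2 * edge a c))
  ((q1 + s) / (2 * edge a c))) => //.
- by rewrite divr_gt0//; lra.
- by rewrite divr_gt0//; lra.
move=> X; rewrite De.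
suff -> : q0 = (q1 ^+ 2 - s ^+ 2) / (4 * edge a c) by field; rewrite gt_eqF.
by rewrite s2; field; rewrite gt_eqF.
Qed.

Lemma Qc_sign_generic a b c : 0 <= c < b -> b <= a ->
  (Qc a b c < 0 <-> exists2 X, 0 < X & 0 < pencil a b c X) /\
  (Qc a b c <= 0 <-> exists2 X, 0 < X & 0 <= pencil a b c X).
Proof.
move=> cb ba; have [n [q1 [q0 [n0 q00 De Qe]]]] := pencil_factor cb ba.
case/andP: (cb) => c0 cb'.
have E0 : 0 < edge a c by apply: edge_gt0; apply/andP; split; lra.
have q1neg := quadratic_root_neg cb ba n0 q00 De.
(* If [-n] were also a root of the quadratic, that factor would have real roots, so [q1 < 0], and
   then every term of its value at [-n] is nonnegative with a positive sum. *)
have res0 : edge a c * n ^+ 2 - q1 * n + q0 != 0.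
  apply/eqP => e.
  have : q1 < 0.
    apply: q1neg; rewrite -subr_ge0 -(pmulr_lge0 _ (exprn_gt0 2 n0)).
    have -> : (q1 ^+ 2 - 4 * edge a c * q0) * n ^+ 2 =
      (edge a c * n ^+ 2 - q0) ^+ 2 - (edge a c * n ^+ 2 + q1 * n + q0) *
      (edge a c * n ^+ 2 - q1 * n + q0) by ring.
    by rewrite e mulr0 subr0 sqr_ge0.
  move=> q1lt; have := mulr_gt0 E0 (exprn_gt0 2 n0).
  have : 0 < - q1 * n by rewrite mulr_gt0//; lra.
  lra.
have [k k0 {}Qe] : exists2 k : R, 0 < k &
    Qc a b c = k * (4 * edge a c * q0 - q1 ^+ 2).
  exists (256 * (edge a c * n ^+ 2 - q1 * n + q0) ^+ 2); last by rewrite Qe; ring.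
  by apply: mulr_gt0; [lra|rewrite lt_neqAle eq_sym sqrf_eq0 res0 sqr_ge0].
rewrite Qe pmulr_rlt0// pmulr_rle0//.
have sq X : 4 * edge a c * (edge a c * X ^+ 2 + q1 * X + q0) =
    (2 * edge a c * X + q1) ^+ 2 + (4 * edge a c * q0 - q1 ^+ 2) by ring.
(* The vertex of the quadratic factor, where the pencil shows the sign of the quadratic's
   discriminant as long as [X0 > 0]. *)
pose X0 := - q1 / (2 * edge a c).
have DX0 : pencil a b c X0 = (X0 + n) * (q1 ^+ 2 - 4 * edge a c * q0) / (4 * edge a c).
  by rewrite De /X0; field; rewrite gt_eqF.
have X00 : q1 < 0 -> 0 < X0 by move=> q1lt; rewrite divr_gt0//; lra.
have E4 : 0 < 4 * edge a c by lra.
split; split.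
- move=> h; have q1lt : q1 < 0 by apply: q1neg; lra.
  exists X0; first exact: X00.
  have := X00 q1lt => X0p.
  by rewrite DX0 divr_gt0// mulr_gt0//; lra.
- move=> [X X1]; rewrite De oppr_gt0 pmulr_rlt0; last lra.
  move=> qX; have := sq X; have := sqr_ge0 (2 * edge a c * X + q1).
  have : 0 < 4 * edge a c * - (edge a c * X ^+ 2 + q1 * X + q0).
    by rewrite mulr_gt0//; lra.
  lra.
- move=> h; have q1lt : q1 < 0 by apply: q1neg; lra.
  exists X0; first exact: X00.
  have := X00 q1lt => X0p.
  by rewrite DX0 divr_ge0 ?(ltW E4)// mulr_ge0//; lra.
- move=> [X X1]; rewrite De oppr_ge0 pmulr_rle0; last lra.
  move=> qX; have := sq X; have := sqr_ge0 (2 * edge a c * X + q1).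
  have : 0 <= 4 * edge a c * - (edge a c * X ^+ 2 + q1 * X + q0).
    by rewrite mulr_ge0//; lra.
  lra.
Qed.

(* For [b = c] the pencil vanishes at 0; this is its slope there. *)
Definition wall_coef a b : R := 4 * b ^+ 2 * (a + b) - kappa a b b.

Lemma pencil_wall a b X :
  pencil a b b X = X * (wall_coef a b * (1 + X) - edge a b * X ^+ 2).
Proof. by rewrite /pencil /wall_coef /kappa /edge; field. Qed.

(** Besides the root 0, the quadratic [w + w X - E X^2] remains, with [w = wall_coef a b] and
    [E = edge a b]: its discriminant is [w^2 + 4 E w] and its resultant with [X] is [w] up to
    sign. *)
Lemma Qc_wall a b :
  Qc a b b = - 256 * (wall_coef a b ^+ 3 * (wall_coef a b + 4 * edge a b)).
Proof. by rewrite /Qc /Q_sym /wall_coef /kappa /edge; field. Qed.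

(** Up to the factor 4 this is [wall_poly_gt] for the pair [(a, b)], with one [a] on its smaller
    side lowered to [b]. *)
Lemma wall_coef_edge_gt0 a b : 0 <= b < a -> 0 < wall_coef a b + 4 * edge a b.
Proof.
move=> ba; have := wall_poly_gt ba; case/andP: ba => b0 ba.
suff -> : wall_coef a b + 4 * edge a b =
  (16 * a ^+ 2 * (a + b) - (2 * (a + 2 * b) - 1)) / 4 by lra.
by rewrite /wall_coef /kappa /edge; field.
Qed.

Lemma wall_coef_diag b : 4 * wall_coef b b = (4 * b - 1) ^+ 2 * (2 * b + 1).
Proof. by rewrite /wall_coef /kappa; field. Qed.

Lemma Qc_sign_wall a b : 0 < b -> b <= a ->
  (Qc a b b < 0 <-> 0 < wall_coef a b) /\ (Qc a b b <= 0 <-> 0 <= wall_coef a b).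
Proof.
have [k k0 ke] : exists2 k : R, 0 < k & 256 = k by exists 256; first lra.
move=> b0; rewrite le_eqVlt => /orP[/eqP<-|ba].
  have -> : Qc b b b = - (k * wall_coef b b ^+ 4).
    by rewrite Qc_wall ke /edge subrr mul0r mulr0 addr0; ring.
  have h : 0 <= wall_coef b b.
    rewrite -(pmulr_rge0 _ (_ : 0 < 4)) // wall_coef_diag.
    by rewrite mulr_ge0 ?sqr_ge0//; lra.
  rewrite oppr_lt0 oppr_le0 pmulr_rgt0// pmulr_rge0// exprn_ge0//.
  by split; rewrite ?h// exprn_even_gt0//= lt_neqAle h eq_sym andbT.
have hE : 0 < wall_coef a b + 4 * edge a b by apply: wall_coef_edge_gt0; rewrite ltW.
have -> : Qc a b b = - (k * (wall_coef a b + 4 * edge a b)) * wall_coef a b ^+ 3.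
  by rewrite Qc_wall ke; ring.
have kE : - (k * (wall_coef a b + 4 * edge a b)) < 0 by rewrite oppr_lt0 mulr_gt0.
by rewrite nmulr_rlt0 ?nmulr_rle0 ?exprn_odd_gt0 ?exprn_odd_ge0.
Qed.
End Sign.

(** * Monotonicity of the sign of Q *)

Section Moves.
Variable R : realType.
Implicit Types a b c X : R.

(** The second alternative covers the wall [b = c], where 0 is a root of the pencil and the slope
    there decides. *)
Lemma Qc_lt0P a b c : 0 <= c <= b -> b <= a -> 0 < b ->
  Qc a b c < 0 <->
  (exists2 X, 0 < X & 0 < pencil a b c X) \/ b = c /\ 0 < wall_coef a b.
Proof.
move=> /andP[c0]; rewrite le_eqVlt => /orP[/eqP->|cb] ba b0.
  have [-> _] := Qc_sign_wall b0 ba; split; first by right.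
  case=> [[X X0]|[]//]; rewrite pencil_wall pmulr_rgt0// => h.
  have : 0 < wall_coef a b * (1 + X).
    by apply: lt_le_trans h _; rewrite gerBl mulr_ge0 ?edge_ge0 ?sqr_ge0.
  by rewrite pmulr_lgt0//; lra.
have [|-> _] := @Qc_sign_generic _ a b c _ ba; first by rewrite c0.
by split; [left|case=> // -[bc]; lra].
Qed.

Lemma Qc_le0P a b c : 0 <= c <= b -> b <= a -> 0 < b -> Qc a b c <= 0 ->
  (exists2 X, 0 < X & 0 <= pencil a b c X) \/ b = c /\ 0 <= wall_coef a b.
Proof.
move=> /andP[c0]; rewrite le_eqVlt => /orP[/eqP->|cb] ba b0.
  by have [_ ->] := Qc_sign_wall b0 ba; right.
by have [|_ ->] := @Qc_sign_generic _ a b c _ ba; [rewrite c0|left].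
Qed.

(** The product of linear factors is homogeneous of degree 3 in [(a, b, c)] but [kappa] is not; this
    is four times [l^3] times the old [kappa] minus the new one. *)
Definition scale_gain (s l : R) := (l - 1) * (2 * s * (l ^+ 2 + l) - (l ^+ 2 + l + 1)).

Lemma pencil_scale l a b c X : pencil (l * a) (l * b) (l * c) X =
  l ^+ 3 * pencil a b c X + X * (1 + X) / 4 * scale_gain (a + b + c) l.
Proof. by rewrite /pencil /kappa /scale_gain; field. Qed.

Lemma wall_coef_scale l a b : wall_coef (l * a) (l * b) =
  l ^+ 3 * wall_coef a b + scale_gain (a + b + b) l / 4.
Proof. by rewrite /wall_coef /kappa /scale_gain; field. Qed.

(* At a zero of the pencil the radial derivative has the sign of
   [a + b + c - 3 / 4]; this is where the constant 3/4 comes from. *)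
Lemma scale_gain_gt0 (s l : R) : 0 < l ->
  (l < 1 /\ s <= 3 / 4) \/ (1 < l /\ 3 / 4 <= s) -> 0 < scale_gain s l.
Proof.
move=> l0; have ll : 0 < l ^+ 2 + l by rewrite addr_gt0 ?exprn_gt0.
case=> -[l1 s34]; rewrite /scale_gain.
  have := ler_wpM2r (ltW ll) (_ : 2 * s <= 3 / 2); move=> /(_ ltac:(lra)) h.
  by rewrite nmulr_lgt0; [lra|nra].
have := ler_wpM2r (ltW ll) (_ : 3 / 2 <= 2 * s); move=> /(_ ltac:(lra)) h.
by apply: mulr_gt0; [lra|nra].
Qed.

(** The same [X], or the same wall slope, serves as witness after scaling, because the gain is
    positive. *)
Lemma Qc_scale l a b c : 0 <= c <= b -> b <= a -> 0 < b -> 0 < l ->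
  (l < 1 /\ a + b + c <= 3 / 4) \/ (1 < l /\ 3 / 4 <= a + b + c) ->
  Qc a b c <= 0 -> Qc (l * a) (l * b) (l * c) < 0.
Proof.
move=> cb ba b0 l0 ls /(Qc_le0P cb ba b0) Q0.
have g0 := scale_gain_gt0 l0 ls.
have l3 : 0 < l ^+ 3 by rewrite exprn_gt0.
case/andP: (cb) => c0 cb'.
apply/Qc_lt0P.
- by rewrite mulr_ge0 ?ler_pM2l// ltW.
- by rewrite ler_pM2l.
- by rewrite mulr_gt0.
case: Q0 => [[X X0 DX]|[bc h]].
  left; exists X => //; rewrite pencil_scale; apply: ltr_wpDl.
    by rewrite mulr_ge0// ltW.
  by rewrite mulr_gt0// divr_gt0 ?mulr_gt0//; lra.
right; split; first by rewrite bc.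
rewrite wall_coef_scale; apply: ltr_wpDl; first by rewrite mulr_ge0// ltW.
by rewrite -bc in g0; rewrite divr_gt0//; lra.
Qed.

Lemma amgm3_lt1 (x y z : R) : 0 <= x -> 0 <= y -> x + y + z < 3 -> x * y * z < 1.
Proof.
move=> x0 y0 xyz; have xy0 : 0 <= x * y by rewrite mulr_ge0.
have [xy|xy] := eqVneq (x * y) 0; first by rewrite xy mul0r.
have {xy} xy : 0 < x * y by rewrite lt_neqAle eq_sym xy.
apply: (@lt_le_trans _ _ (x * y * (3 - (x + y)))); first by rewrite ltr_pM2l//; lra.
have [s3|s3] := leP 3 (x + y).
  by apply: (@le_trans _ _ 0) => //; rewrite mulr_ge0_le0//; lra.
apply: (@le_trans _ _ ((x + y) ^+ 2 / 4 * (3 - (x + y)))).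
  rewrite ler_pM2r; last lra.
  by have := sqr_ge0 (x - y); rewrite !expr2; lra.
(* With [p = x + y] this product is [4 - p^2 (3 - p)]. *)
have : 0 <= (x + y - 2) ^+ 2 * (x + y + 1) by rewrite mulr_ge0 ?sqr_ge0//; lra.
rewrite !expr2; lra.
Qed.

Lemma wall_coef_mid b : 4 * wall_coef (3 / 4 - 2 * b) b =
  - ((1 - 4 * b) * (1 / 2 + 2 * b - 4 * b ^+ 2)).
Proof. by rewrite /wall_coef /kappa; field. Qed.

(** On this plane [kappa] is 1/8, so the aim is [u v w < X (1 + X) / 8] for [X > 0]. At the centre
    [u], [v / X] and [w / (1 + X)] all equal 1/2, which dictates the normalisation for AM-GM. *)
Lemma Qc_mid_plane_gt0 a b c : 0 <= c <= b -> b <= a -> 0 < b ->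
  a + b + c = 3 / 4 -> a != 4^-1 -> 0 < Qc a b c.
Proof.
move=> cb ba b0 s34 a4; rewrite ltNge; apply/negP => /(Qc_le0P cb ba b0).
case/andP: (cb) => c0 cb'.
have {}a4 : 1 / 4 < a.
  rewrite lt_neqAle eq_sym; apply/andP; split; last lra.
  by apply: contra_neq a4; lra.
case=> [[X X0]|[bc]]; last first.
  have -> : a = 3 / 4 - 2 * b by lra.
  apply/negP; rewrite -ltNge -(pmulr_rlt0 _ (_ : 0 < 4))// wall_coef_mid oppr_lt0.
  by apply: mulr_gt0; nra.
apply/negP; rewrite -ltNge /pencil /kappa s34.
set u := _ - _ * X; set v := _ * X - _; set w := _ + _ * X.
pose T := 1 + X; have T0 : 0 < T by rewrite /T; lra.
have XT : 0 < X * T by rewrite mulr_gt0.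
suff : u * v * w < X * T / 8 by rewrite /T; lra.
have w0 : 0 <= w by rewrite addr_ge0 ?mulr_ge0//; lra.
have XT8 : 0 < X * T / 8 by lra.
have uv : u + v = 2 * c * T by rewrite /u /v /T; ring.
have uv0 : 0 <= u + v by rewrite uv !mulr_ge0//; lra.
(* [u] and [v] are not both negative, so a negative one makes the product nonpositive. *)
have [u0|u0] := ltP u 0.
  by apply: le_lt_trans XT8; rewrite mulr_le0_ge0// mulr_le0_ge0//; lra.
have [v0|v0] := ltP v 0.
  by apply: le_lt_trans XT8; rewrite mulr_le0_ge0// mulr_ge0_le0//; lra.
(* AM-GM: the three factors below sum to less than 3. *)
suff : 2 * u * (2 * v / X) * (2 * w / T) < 1.
  have -> : 2 * u * (2 * v / X) * (2 * w / T) = 8 * (u * v * w) / (X * T).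
    by field; rewrite !gt_eqF.
  by rewrite ltr_pdivrMr//; lra.
apply: amgm3_lt1; [lra|by rewrite divr_ge0//; lra|].
have -> : 2 * u + 2 * v / X + 2 * w / T =
  (2 * u * (X * T) + 2 * v * T + 2 * w * X) / (X * T) by field; rewrite !gt_eqF.
rewrite ltr_pdivrMr// -subr_gt0.
(* On the plane [f] equals [(b - c) / 2]; the deficit in the sum is a combination of [e > 0] and
   [f >= 0] with positive coefficients. *)
pose e := a - 1 / 4; pose f := b - 1 / 4 + e / 2.
have -> : 3 * (X * T) - (2 * u * (X * T) + 2 * v * T + 2 * w * X) =
  e * (X * T + 2 * X * (X * T) + 2 * X + X ^+ 3) +
  2 * f * (X * (X * T) + X * T + 2 * T + X ^+ 2).
  have ce : c = 3 / 4 - a - b by lra.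
  by rewrite /u /v /w /f /e /T ce; field.
have e0 : 0 < e by rewrite /e; lra.
have f0 : 0 <= f by rewrite /f /e; lra.
have X2 := exprn_gt0 2 X0; have X3 := exprn_gt0 3 X0; have XXT := mulr_gt0 X0 XT.
by rewrite ltr_wpDr ?mulr_gt0 ?mulr_ge0//; lra.
Qed.

(** If [u] and [v] are nonnegative, [u], [v], [w] are bounded separately. The product of the bounds
    stays below the [kappa] term because [c <= 1/8] and [b + c <= 1/4]. *)
Lemma Qc_face_gt0 b c : 0 <= c <= b -> 0 < b -> b + c <= 1 / 4 ->
  0 < Qc (1 / 2) b c.
Proof.
move=> cb b0 bc4; case/andP: (cb) => c0 cb'.
rewrite ltNge; apply/negP => /(Qc_le0P cb _ b0) []; first lra; last first.
  move=> [bc]; apply/negP; rewrite -ltNge.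
  have -> : wall_coef (1 / 2) b = - (b * (1 - 2 * b - 4 * b ^+ 2)).
    by rewrite /wall_coef /kappa; field.
  by rewrite oppr_lt0 mulr_gt0//; nra.
move=> [X X0]; apply/negP; rewrite -ltNge /pencil.
have -> : kappa (1 / 2) b c = (c + b) / 2 by rewrite /kappa; field.
set u := _ - _ * X; set v := _ * X - _; set w := _ + _ * X.
have uv0 : 0 <= u + v.
  have -> : u + v = 2 * c * (1 + X) by rewrite /u /v; ring.
  by rewrite !mulr_ge0//; lra.
have w0 : 0 <= w by rewrite addr_ge0 ?mulr_ge0//; lra.
have XX := mulr_gt0 X0 X0.
have K0 : 0 < (c + b) / 2 * X * (1 + X) by rewrite !mulr_gt0//; lra.
suff : u * v * w < (c + b) / 2 * X * (1 + X) by lra.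
have [u0|u0] := ltP u 0.
  by apply: le_lt_trans K0; rewrite mulr_le0_ge0// mulr_le0_ge0//; lra.
have [v0|v0] := ltP v 0.
  by apply: le_lt_trans K0; rewrite mulr_le0_ge0// mulr_ge0_le0//; lra.
have dX0 : 0 <= (1 / 2 - c) * X by rewrite mulr_ge0//; lra.
have d0 : 0 < 1 / 2 - c by lra.
have up : u <= c + b by rewrite /u; lra.
have vp : v <= (c + 1 / 2) * X by rewrite /v; lra.
(* Eliminating [X] between [u] and [w] turns [u >= 0] into an upper bound on [w]. *)
have wp : (1 / 2 - c) * w <= c + b.
  have -> : (1 / 2 - c) * w = (c + b) - (c + 1 / 2) * u by rewrite /u /w; field.
  by rewrite gerBl mulr_ge0//; lra.
rewrite -(ltr_pM2l d0).
apply: (@le_lt_trans _ _ ((c + b) * ((c + 1 / 2) * X) * (c + b))).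
  have -> : (1 / 2 - c) * (u * v * w) = u * v * ((1 / 2 - c) * w) by ring.
  by rewrite !ler_pM// mulr_ge0// ltW.
have -> : (c + b) * ((c + 1 / 2) * X) * (c + b) =
  ((c + b) * X) * ((c + 1 / 2) * (c + b)) by ring.
have -> : (1 / 2 - c) * ((c + b) / 2 * X * (1 + X)) =
  ((c + b) * X) * ((1 / 2 - c) / 2 * (1 + X)).
  by field.
rewrite ltr_pM2l ?mulr_gt0//; [nra|lra].
Qed.

(** The first two linear factors are [c (1 + X)] minus and plus [a X - b]. *)
Lemma pencil_square a b c X : pencil a b c X =
  ((c * (1 + X)) ^+ 2 - (a * X - b) ^+ 2) * (c * (1 + X) + (b + a * X))
  - kappa a b c * X * (1 + X).
Proof. by rewrite /pencil; ring. Qed.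

(** At [X = b / a] the subtracted square of [pencil_square] vanishes, and [kappa] is nonpositive
    here. *)
Lemma Qc_small_lt0 a b c : 0 < c <= b -> b <= a -> a + b + c <= 1 / 2 ->
  Qc a b c < 0.
Proof.
move=> /andP[c0 cb] ba s12; apply/Qc_lt0P; [by rewrite ltW|by []|lra|].
have k0 : kappa a b c <= 0 by rewrite /kappa; lra.
have X0 : 0 < b / a by rewrite divr_gt0//; lra.
have T : 0 < 1 + b / a by rewrite addr_gt0.
left; exists (b / a) => //; rewrite pencil_square.
have -> : a * (b / a) = b by field; rewrite gt_eqF//; lra.
rewrite subrr expr0n /= subr0 ltr_wpDr//.
  rewrite -!mulNr; apply: mulr_ge0; last exact: ltW.
  by apply: mulr_ge0; [lra|exact: ltW].
by rewrite mulr_gt0 ?exprn_gt0 ?addr_gt0 ?mulr_gt0//; lra.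
Qed.

(* At a nonnegative value of the pencil, [a <= 1 / 2] and [1 / 8 <= kappa] bound
   below the gain from raising [c]. *)
Lemma Qc_raise a b c c' : 0 <= c < c' -> c' <= b -> b <= a -> a <= 1 / 2 ->
  3 / 4 <= a + b + c -> Qc a b c <= 0 -> Qc a b c' < 0.
Proof.
move=> /andP[c0 cc] cb ba a12 s34.
have b0 : 0 < b by lra.
have cb' : 0 <= c <= b by rewrite c0; lra.
case/(Qc_le0P cb' ba b0) => [[X X0]|[bc _]]; last lra.
have c'b : 0 <= c' <= b by rewrite cb andbT; lra.
move=> DX; apply/(Qc_lt0P c'b ba b0); left; exists X => //.
pose T := 1 + X; have T0 : 0 < T by rewrite /T; lra.
move: DX; rewrite !pencil_square -/T.
set m := a * X - b; set w := b + a * X => DX.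
have w0 : 0 < w by rewrite ltr_wpDr ?mulr_ge0//; lra.
have k8 : 1 / 8 <= kappa a b c by rewrite /kappa; lra.
have XT : 0 < X * T by rewrite mulr_gt0.
have cT0 : 0 <= c * T by rewrite mulr_ge0// ltW.
have W0 : 0 < c * T + w by rewrite ltr_wpDl.
have kXT : 1 / 8 * (X * T) <= kappa a b c * (X * T) by rewrite ler_pM2r.
have Pm : 0 < ((c * T) ^+ 2 - m ^+ 2).
  rewrite -(pmulr_lgt0 _ W0); lra.
have c0' : 0 < c.
  rewrite lt_neqAle c0 andbT eq_sym; apply/eqP => c0'.
  by move: Pm; rewrite c0' mul0r expr0n /= sub0r oppr_gt0 ltNge sqr_ge0.
(* In [c] the [kappa] term grows at rate [X T / 2] and the cubic term at rate at least
   [2 c T^2 (c T + w)]; this bound compares the two. *)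
have key : X / 4 <= c * T * (c * T + w).
  have h1 : 1 / 8 * (X * T) <= (c * T) ^+ 2 * (c * T + w).
    have : 0 <= m ^+ 2 * (c * T + w) by rewrite mulr_ge0 ?sqr_ge0 ?ltW.
    lra.
  have h2 : 1 / 8 * X <= c * (c * T * (c * T + w)).
    by rewrite -(ler_pM2r T0); lra.
  have h3 : c * (c * T * (c * T + w)) <= 1 / 2 * (c * T * (c * T + w)).
    by rewrite ler_pM2r ?mulr_gt0//; lra.
  lra.
pose d := c' - c; have d0 : 0 < d by rewrite /d; lra.
have -> : ((c' * T) ^+ 2 - m ^+ 2) * (c' * T + w) - kappa a b c' * X * T =
  (((c * T) ^+ 2 - m ^+ 2) * (c * T + w) - kappa a b c * X * T) +
  d * T * (2 * (c * T * (c * T + w) - X / 4) + ((c * T) ^+ 2 - m ^+ 2) +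
    d * T * (c * T + w) + (2 * c + d) * T * (d * T)).
  by rewrite /d /kappa; field.
rewrite ltr_wpDl// mulr_gt0 ?mulr_gt0//.
have dT := mulr_gt0 d0 T0.
have e1 : 0 < d * T * (c * T + w) by rewrite mulr_gt0.
have e2 : 0 < (2 * c + d) * T * (d * T) by rewrite !mulr_gt0//; lra.
lra.
Qed.

(** At [c = 0] the difference of squares is minus a square and [kappa] is positive, so the pencil is
    negative for [X > 0]. *)
Lemma Qc_floor_gt0 a b : 0 < b <= a -> 1 / 2 < a + b -> 0 < Qc a b 0.
Proof.
move=> /andP[b0 ba] ab; rewrite ltNge; apply/negP.
case/(Qc_le0P _ ba b0) => [|[X X0]|[]]; [by rewrite lexx ltW| |lra].
apply/negP; rewrite -ltNge pencil_square mul0r expr0n /= sub0r add0r.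
have k0 : 0 < kappa a b 0 by rewrite /kappa; lra.
have aX : 0 < a * X by rewrite mulr_gt0//; lra.
have h1 : 0 <= (a * X - b) ^+ 2 * (b + a * X).
  by rewrite mulr_ge0 ?sqr_ge0//; lra.
have h2 : 0 < kappa a b 0 * X * (1 + X) by rewrite !mulr_gt0//; lra.
lra.
Qed.

Lemma Qc_diag_lt0 b : 0 < b -> b != 1 / 4 -> Qc b b b < 0.
Proof.
move=> b0 b4; have [-> _] := Qc_sign_wall b0 (lexx b).
rewrite -(pmulr_rgt0 _ (_ : 0 < 4)) // wall_coef_diag mulr_gt0//; last lra.
rewrite lt_neqAle eq_sym sqrf_eq0 sqr_ge0 andbT.
by apply: contra_neq b4; lra.
Qed.

Lemma wall_coef_affine x y b :
  wall_coef x b = wall_coef y b + (x - y) * (8 * b ^+ 2 - 1) / 2.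
Proof. by rewrite /wall_coef /kappa; field. Qed.

Lemma wall_coef_interp a a' b :
  (a - b) * wall_coef a' b = (a - a') * wall_coef b b + (a' - b) * wall_coef a b.
Proof. by rewrite (wall_coef_affine a b) (wall_coef_affine a' b); field. Qed.

(** For [b < 1/4] the coefficient is negative on the plane [s1 = 3/4] and decreases in [a], since
    [8 b^2 < 1]. *)
Lemma wall_coef_ge0 a b :
  0 < b -> 3 / 4 <= a + b + b -> 0 <= wall_coef a b -> 1 / 4 <= b.
Proof.
move=> b0 s34 h; rewrite leNgt; apply/negP => b4.
have h1 : wall_coef (3 / 4 - 2 * b) b < 0.
  rewrite -(pmulr_rlt0 _ (_ : 0 < 4))// wall_coef_mid oppr_lt0.
  by apply: mulr_gt0; nra.
have := wall_coef_affine a (3 / 4 - 2 * b) b.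
have : 0 <= (a - (3 / 4 - 2 * b)) * (1 - 8 * b ^+ 2) by apply: mulr_ge0; nra.
lra.
Qed.

(** [wall_coef] is affine in its first argument, so its value at [a'] interpolates between the given
    one at [a] and the diagonal one, which is nonnegative. *)
Lemma Qc_wall_le_lower a a' b : 0 < b <= a' -> a' <= a -> 3 / 4 <= a + b + b ->
  Qc a b b <= 0 -> 1 / 4 <= b /\ Qc a' b b <= 0.
Proof.
move=> /andP[b0 ba'] a'a s34; have ba : b <= a by lra.
have [_ ->] := Qc_sign_wall b0 ba; have [_ ->] := Qc_sign_wall b0 ba'.
move=> h; split; first exact: wall_coef_ge0 h.
have hb : 0 <= wall_coef b b.
  by rewrite -(pmulr_rge0 _ (_ : 0 < 4)) // wall_coef_diag mulr_ge0 ?sqr_ge0//; lra.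
have [ab|ab] := eqVneq a b; first by have -> : a' = b by lra.
have {}ab : 0 < a - b by rewrite subr_gt0 lt_neqAle eq_sym ab.
rewrite -(pmulr_rge0 _ ab) wall_coef_interp.
by apply: addr_ge0; apply: mulr_ge0 => //; lra.
Qed.

Lemma Qc_wall_lt_lower a a' b : 0 < b <= a' -> a' <= a -> 3 / 4 < a + b + b ->
  Qc a b b < 0 -> 1 / 4 < b /\ Qc a' b b < 0.
Proof.
move=> /andP[b0 ba'] a'a s34; have ba : b <= a by lra.
have [-> _] := Qc_sign_wall b0 ba; have [-> _] := Qc_sign_wall b0 ba'.
move=> h; have b4 : 1 / 4 < b.
  rewrite lt_neqAle (wall_coef_ge0 b0 (ltW s34) (ltW h)) andbT.
  (* At [b = 1/4] the coefficient is [-(a - 1/4) / 4], which is negative. *)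
  apply/eqP => b4; move: h; rewrite (wall_coef_affine a (1 / 4)) /wall_coef /kappa -b4.
  have : 0 < a - 1 / 4 by lra.
  lra.
split=> //.
have hb : 0 < wall_coef b b.
  rewrite -(pmulr_rgt0 _ (_ : 0 < 4)) // wall_coef_diag mulr_gt0//; last lra.
  by rewrite exprn_gt0//; lra.
have [->|ab] := eqVneq a' b => //.
have {}ab : 0 < a' - b by rewrite subr_gt0 lt_neqAle eq_sym ab.
rewrite -(pmulr_rgt0 _ (_ : 0 < a - b)); last lra.
rewrite wall_coef_interp; apply: ltr_wpDl; last exact: mulr_gt0.
by apply: mulr_ge0; [lra|exact: ltW].
Qed.
End Moves.

(** * Topological tools *)

Section Continuity.
Variable R : realType.

Lemma continuous_add (T : topologicalType) (f g : T -> R) :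
  continuous f -> continuous g -> continuous (fun t => f t + g t).
Proof. by move=> cf cg t; apply: cvgD; [exact: cf|exact: cg]. Qed.

Lemma continuous_opp (T : topologicalType) (f : T -> R) :
  continuous f -> continuous (fun t => - f t).
Proof. by move=> cf t; apply: cvgN; exact: cf. Qed.

Lemma continuous_mul (T : topologicalType) (f g : T -> R) :
  continuous f -> continuous g -> continuous (fun t => f t * g t).
Proof. by move=> cf cg t; apply: cvgM; [exact: cf|exact: cg]. Qed.

Lemma continuous_exp (T : topologicalType) (f : T -> R) n :
  continuous f -> continuous (fun t => f t ^+ n).
Proof.
move=> cf t; apply: (@cvg_comp _ _ _ f (fun x => x ^+ n) _ (nbhs (f t))).
  exact: cf.
exact: exprn_continuous.
Qed.

End Continuity.

Ltac continuity := repeat lazymatch goal with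
  | |- continuous (fun t => @?f t + @?g t) => apply: (@continuous_add _ _ f g)
  | |- continuous (fun t => - @?f t) => apply: (@continuous_opp _ _ f)
  | |- continuous (fun t => @?f t * @?g t) => apply: (@continuous_mul _ _ f g)
  | |- continuous (fun t => @?f t ^+ ?n) => apply: (@continuous_exp _ _ f n)
  | |- continuous (fun t => t) => move=> ?; exact: cvg_id
  | |- continuous (fun t => ?c) => move=> ?; exact: cvg_cst
  | |- continuous _ => assumption
  end.

Section Vectors.
Variable R : realType.

Lemma continuous_Qc (T : topologicalType) (f g h : T -> R) :
  continuous f -> continuous g -> continuous h ->
  continuous (fun t => Qc (f t) (g t) (h t)).
Proof. by move=> cf cg ch; rewrite /Qc /Q_sym; continuity. Qed.

Lemma continuous_coord (i : 'I_3) : continuous (fun v : 'rV[R]_3 => v 0 i).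
Proof. exact: coord_continuous. Qed.

Definition vec (a b c : R) : 'rV[R]_3 :=
  \row_i (if i == 0 then a else if i == 1 then b else c).

Lemma vec0 a b c : vec a b c 0 0 = a. Proof. by rewrite mxE. Qed.
Lemma vec1 a b c : vec a b c 0 1 = b. Proof. by rewrite mxE. Qed.
Lemma vec2 a b c : vec a b c 0 2 = c. Proof. by rewrite mxE. Qed.
Definition vecE := (vec0, vec1, vec2).

Lemma ord3P (P : 'I_3 -> Prop) : P 0 -> P 1 -> P 2 -> forall i, P i.
Proof.
move=> P0 P1 P2 [[|[|[|//]]] i3].
- by have -> : Ordinal i3 = 0 by apply: val_inj.
- by have -> : Ordinal i3 = 1 by apply: val_inj.
- by have -> : Ordinal i3 = 2 by apply: val_inj.
Qed.

Lemma vecK (v : 'rV[R]_3) : vec (v 0 0) (v 0 1) (v 0 2) = v.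
Proof. by apply/rowP; apply: ord3P; rewrite ?vecE. Qed.

Lemma Q_vec a b c : Q (vec a b c) = Qc a b c.
Proof. by rewrite /Q /s1 /s2 /s3 !vecE. Qed.

Lemma scale_vec l a b c : l *: vec a b c = vec (l * a) (l * b) (l * c).
Proof. by apply/rowP; apply: ord3P; rewrite mxE !vecE. Qed.

Lemma continuous_vec (T : topologicalType) (f g h : T -> R) :
  continuous f -> continuous g -> continuous h ->
  continuous (fun t => vec (f t) (g t) (h t)).
Proof.
move=> cf cg ch.
have -> : (fun t => vec (f t) (g t) (h t)) =
    (fun t => f t *: vec 1 0 0 + g t *: vec 0 1 0 + h t *: vec 0 0 1).
  apply/funext => t; apply/rowP; apply: ord3P;
  by rewrite !mxE /= !(mulr0, mulr1, addr0, add0r).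
move=> t.
by apply: cvgD; [apply: cvgD|]; apply: continuousZr_tmp;
  [exact: cf|exact: cg|exact: ch].
Qed.

Lemma continuous_Q : continuous (@Q R).
Proof.
have -> : @Q R = (fun v : 'rV[R]_3 => Qc (v 0 0) (v 0 1) (v 0 2)).
  by apply/funext => v; rewrite -{1}(vecK v) Q_vec.
by apply: continuous_Qc; exact: continuous_coord.
Qed.

Lemma continuous_s1 : continuous (@s1 R).
Proof.
by apply: continuous_add; [apply: continuous_add|]; exact: continuous_coord.
Qed.
End Vectors.

(** * Connected components under maps, and connectedness of graphs *)

Section Connectedness.

Lemma connected_component_image (T U : topologicalType) (f : T -> U)
    (A : set T) (B : set U) x y :
  continuous f -> (forall z, A z -> B (f z)) ->
  connected_component A x y -> connected_component B (f x) (f y).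
Proof.
move=> cf AB [C [Cx CA cC] Cy].
apply: (@connected_component_max _ B (f @` C)).
- by exists x.
- by move=> _ [z Cz <-]; exact/AB/CA.
- by apply: connected_continuous_connected => //; exact: continuous_subspaceT.
- by exists y.
Qed.

Lemma connected_of_component (T : topologicalType) (A : set T) x :
  (forall y, A y -> connected_component A x y) -> connected A.
Proof.
move=> h; have -> : A = connected_component A x.
  by apply/seteqP; split=> // y; exact: connected_component_sub.
exact: component_connected.
Qed.

(** Each fibre crosses [S] once, at height [s u], from [U] to [N]. Openness of [U] and [N] makes [s]
    continuous on [B], and the set is the image of [B] under [u |-> F (u, s u)]. *)
Lemma connected_graph (R : realType) (T V : topologicalType) (B : set T)
    (F : T * R -> V) (S U N : set V) :
  connected B -> continuous F -> open U -> open N ->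
  S `&` U = set0 -> S `&` N = set0 -> U `&` N = set0 ->
  (forall u, B u -> exists s : R, [/\ 0 <= s <= 1, S (F (u, s)),
    forall r : R, 0 <= r < s -> U (F (u, r)) &
    forall r : R, s < r <= 1 -> N (F (u, r))]) ->
  connected (S `&` (F @` (B `*` `[0, 1]))).
Proof.
move=> cB cF oU oN SU SN UN hs.
have [s sP] : exists s : T -> R, forall u, B u -> [/\ 0 <= s u <= 1, S (F (u, s u)),
    forall r : R, 0 <= r < s u -> U (F (u, r)) &
    forall r : R, s u < r <= 1 -> N (F (u, r))].
  suff [s sP] : {s : T -> R & forall u, B u -> [/\ 0 <= s u <= 1, S (F (u, s u)),
    forall r : R, 0 <= r < s u -> U (F (u, r)) &
    forall r : R, s u < r <= 1 -> N (F (u, r))]} by exists s.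
  apply: (@choice _ _ (fun u (s : R) => B u -> [/\ 0 <= s <= 1, S (F (u, s)),
    forall r : R, 0 <= r < s -> U (F (u, r)) &
    forall r : R, s < r <= 1 -> N (F (u, r))])) => u.
  by have [Bu|nBu] := pselect (B u); [have [s ?] := hs u Bu; exists s|exists 0].
have disj (X Y : set V) v : X `&` Y = set0 -> X v -> Y v -> False.
  by move=> XY Xv Yv; have : (X `&` Y) v by []; rewrite XY.
have cFr r : continuous (fun u => F (u, r)).
  move=> u; apply: (@cvg_comp _ _ _ (fun u => (u, r)) F _ (nbhs (u, r))).
    apply: (@cvg_pair _ _ _ (nbhs u) (nbhs u) (nbhs r) _ _ _ id (fun=> r)).
      exact: cvg_id.
    exact: cvg_cst.
  exact: cF.
have cs : {within B, continuous s}.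
  apply/subspace_continuousP => u Bu.
  have [/andP[su0 su1] Su Uu Nu] := sP u Bu.
  apply/cvgrPdist_lt => e e0; rewrite /from_subspace.
  (* The heights [s u + e / 2] and [s u - e / 2] stay in [N] and [U] for nearby base points and trap
     the crossing; the guards cover heights outside [0, 1]. *)
  have nN : \forall u' \near within B (nbhs u),
      s u + e / 2 <= 1 -> N (F (u', s u + e / 2)).
    have [r1|r1] := leP (s u + e / 2) 1; last by apply: nearW.
    have Nr : N (F (u, s u + e / 2)) by apply: Nu; apply/andP; split; lra.
    have : nbhs u (fun v => N (F (v, s u + e / 2))).
      exact: (cFr _ u _ (open_nbhs_nbhs (conj oN Nr))).
    by move=> h; apply: cvg_within; apply: filterS h.
  have nU : \forall u' \near within B (nbhs u),
      0 <= s u - e / 2 -> U (F (u', s u - e / 2)).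
    have [r1|r1] := leP 0 (s u - e / 2); last by apply: nearW.
    have Ur : U (F (u, s u - e / 2)) by apply: Uu; apply/andP; split; lra.
    have : nbhs u (fun v => U (F (v, s u - e / 2))).
      exact: (cFr _ u _ (open_nbhs_nbhs (conj oU Ur))).
    by move=> h; apply: cvg_within; apply: filterS h.
  near=> u'.
  have Bu' : B u' by near: u'; exact: withinT.
  have nN' : s u + e / 2 <= 1 -> N (F (u', s u + e / 2)) by near: u'.
  have nU' : 0 <= s u - e / 2 -> U (F (u', s u - e / 2)) by near: u'.
  have [/andP[s0 s1] S' U' N'] := sP u' Bu'.
  rewrite ltr_norml; apply/andP; split.
  - rewrite ltrNl opprB ltrBlDr ltNge; apply/negP => h.
    have Nr : N (F (u', s u + e / 2)) by apply: nN'; lra.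
    by apply: (disj _ _ _ UN (U' _ _) Nr); apply/andP; split; lra.
  - rewrite ltrBlDr -ltrBlDl ltNge; apply/negP => h.
    have Ur : U (F (u', s u - e / 2)) by apply: nU'; lra.
    by apply: (disj _ _ _ UN Ur (N' _ _)); apply/andP; split; lra.
have -> : S `&` (F @` (B `*` `[0, 1])) = (fun u => F (u, s u)) @` B.
  apply/seteqP; split => v.
    move=> [Sv [[u r] [/= Bu r01] Fv]]; exists u => //.
    have [/andP[s0 s1'] S' U' N'] := sP u Bu.
    move: r01; rewrite in_itv /= => /andP[r0 r1].
    have [rs|rs|rs] := ltgtP r (s u); last by rewrite -rs.
      by exfalso; apply: (disj _ _ v SU Sv); rewrite -Fv; apply: U'; rewrite r0.
    by exfalso; apply: (disj _ _ v SN Sv); rewrite -Fv; apply: N'; rewrite rs.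
  move=> [u Bu <-]; have [s01 S' _ _] := sP u Bu.
  by split => //; exists (u, s u) => //; split => //=; rewrite in_itv.
apply: connected_continuous_connected => //.
apply/subspace_continuousP => u Bu.
move/subspace_continuousP : cs => /(_ u Bu) csu.
apply: (@cvg_comp _ _ _ (fun u => (u, s u)) F _ (nbhs (u, s u))).
  by apply: (@cvg_pair _ _ _ _ (nbhs u) (nbhs (s u)) _ _ _ id s) => //;
    exact: cvg_within.
exact: cF.
Unshelve. all: by end_near. Qed.
End Connectedness.

(** * Connected pieces of the complement *)

Section Regions.
Variable R : realType.
Implicit Types a b c l t u x y p q : R.

Lemma Qc_swap01 a b c : Qc b a c = Qc a b c.
Proof. by rewrite /Qc; congr Q_sym; ring. Qed.

Lemma Qc_swap12 a b c : Qc a c b = Qc a b c.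
Proof. by rewrite /Qc; congr Q_sym; ring. Qed.

(** The two adjacent transpositions generate all permutations of the coordinates. *)
Lemma sorted_ind (P : R -> R -> R -> Prop) :
  (forall a b c, P a b c -> P b a c) -> (forall a b c, P a b c -> P a c b) ->
  (forall a b c, c <= b -> b <= a -> P a b c) -> forall a b c, P a b c.
Proof.
move=> P01 P12 Ps a b c.
wlog ba : a b / b <= a => [h|].
  by have [/h//|/ltW /h] := leP b a; exact: P01.
have [cb|/ltW bc] := leP c b; first exact: Ps.
have [ca|/ltW ac] := leP c a; first exact/P12/Ps.
exact/P12/P01/Ps.
Qed.

Definition swap01 (v : 'rV[R]_3) := vec (v 0 1) (v 0 0) (v 0 2).
Definition swap12 (v : 'rV[R]_3) := vec (v 0 0) (v 0 2) (v 0 1).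

Lemma continuous_swap01 : continuous swap01.
Proof. by apply: continuous_vec; exact: continuous_coord. Qed.

Lemma continuous_swap12 : continuous swap12.
Proof. by apply: continuous_vec; exact: continuous_coord. Qed.

(** Paths from sorted points to the base point are transported by the transpositions. They then end
    at a transposed base point, which is why the base point must be joined to its two transposes. *)
Lemma connected_symmetric (A : set 'rV[R]_3) a0 b0 c0 :
  (forall a b c, A (vec a b c) -> A (vec b a c)) ->
  (forall a b c, A (vec a b c) -> A (vec a c b)) ->
  connected_component A (vec a0 b0 c0) (vec b0 a0 c0) ->
  connected_component A (vec a0 b0 c0) (vec a0 c0 b0) ->
  (forall a b c, c <= b -> b <= a -> A (vec a b c) ->
    connected_component A (vec a0 b0 c0) (vec a b c)) ->
  connected A.
Proof.
move=> A01 A12 w01 w12 As; apply: (@connected_of_component _ _ (vec a0 b0 c0)).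
suff h a b c : A (vec a b c) -> connected_component A (vec a0 b0 c0) (vec a b c).
  by move=> v; rewrite -(vecK v); exact: h.
move: a b c; apply: sorted_ind => // a b c h Av.
- apply: connected_component_trans w01 _.
  have := connected_component_image continuous_swap01 _ (h (A01 _ _ _ Av)).
  by rewrite /swap01 !vecE; apply => v; rewrite -{1}(vecK v); exact: A01.
- apply: connected_component_trans w12 _.
  have := connected_component_image continuous_swap12 _ (h (A12 _ _ _ Av)).
  by rewrite /swap12 !vecE; apply => v; rewrite -{1}(vecK v); exact: A12.
Qed.

Lemma component_segment (A : set 'rV[R]_3) a b c a' b' c' :
  (forall u t, 0 <= u -> 0 <= t -> u + t = 1 ->
    A (vec (u * a + t * a') (u * b + t * b') (u * c + t * c'))) ->
  connected_component A (vec a b c) (vec a' b' c').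
Proof.
move=> At.
pose g t := vec ((1 - t) * a + t * a') ((1 - t) * b + t * b') ((1 - t) * c + t * c').
have cg : continuous g by rewrite /g; apply: continuous_vec; continuity.
have g0 : g 0 = vec a b c by rewrite /g !subr0 !mul0r !addr0 !mul1r.
have g1 : g 1 = vec a' b' c' by rewrite /g !subrr !mul0r !add0r !mul1r.
apply: (@connected_component_max _ A (g @` `[0, 1]%classic) (vec a b c)).
- by exists 0 => //=; rewrite in_itv /= lexx ler01.
- move=> _ [t /= t01 <-]; move: t01; rewrite in_itv /= => /andP[t0 t1].
  by apply: At; lra.
- apply: connected_continuous_connected; first exact: segment_connected.
  exact: continuous_subspaceT.
- by exists 1 => //=; rewrite in_itv /= lexx ler01.
Qed.

Lemma conv_le u t x y p q : 0 <= u -> 0 <= t -> x <= p -> y <= q ->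
  u * x + t * y <= u * p + t * q.
Proof. by move=> u0 t0 xp yq; apply: lerD; apply: ler_wpM2l. Qed.

Lemma conv_lt u t x y p q : 0 <= u -> 0 <= t -> u + t = 1 -> x < p -> y < q ->
  u * x + t * y < u * p + t * q.
Proof.
move=> u0 t0 ut xp yq; have [te|tn0] := eqVneq t 0.
  have -> : u = 1 by lra.
  by rewrite te !mul0r !addr0 !mul1r.
apply: ler_ltD; first by apply: ler_wpM2l => //; exact: ltW.
by rewrite ltr_pM2l// lt_neqAle eq_sym tn0.
Qed.

Lemma conv_id u t x : u + t = 1 -> u * x + t * x = x.
Proof. by move=> ut; rewrite -mulrDl ut mul1r. Qed.

Lemma conv_itv u t x y p : 0 <= u -> 0 <= t -> u + t = 1 ->
  0 < x <= p -> 0 < y <= p -> 0 < u * x + t * y <= p.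
Proof.
move=> u0 t0 ut /andP[x0 xp] /andP[y0 yp]; apply/andP; split.
  by rewrite -[ltLHS](conv_id 0 ut); exact: conv_lt.
by rewrite -[leRHS](conv_id p ut); exact: conv_le.
Qed.

Lemma cube_vec a b c :
  cube R (vec a b c) <-> [/\ 0 < a <= 1 / 2, 0 < b <= 1 / 2 & 0 < c <= 1 / 2].
Proof.
split; first by move=> h; have := h 0; have := h 1; have := h 2; rewrite !vecE.
by case=> ha hb hc; apply: ord3P; rewrite vecE.
Qed.

Lemma s1_vec a b c : s1 (vec a b c) = a + b + c.
Proof. by rewrite /s1 !vecE. Qed.

(** The plane [s1 = 3/4] can separate the two parts of [Q < 0] because [Q >= 0] on it in the
    positive octant. *)
Definition upper : set 'rV[R]_3 := [set v | Q v < 0 /\ 3 / 4 < s1 v].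
Definition lower : set 'rV[R]_3 := [set v | Q v < 0 /\ s1 v < 3 / 4].
Definition outside : set 'rV[R]_3 := [set v | 0 < Q v].

Lemma upper_vec a b c : (cube R `&` upper) (vec a b c) <->
  [/\ 0 < a <= 1 / 2, 0 < b <= 1 / 2 & 0 < c <= 1 / 2] /\
  Qc a b c < 0 /\ 3 / 4 < a + b + c.
Proof. by rewrite /upper /= -cube_vec Q_vec s1_vec. Qed.

Lemma lower_vec a b c : (cube R `&` lower) (vec a b c) <->
  [/\ 0 < a <= 1 / 2, 0 < b <= 1 / 2 & 0 < c <= 1 / 2] /\
  Qc a b c < 0 /\ a + b + c < 3 / 4.
Proof. by rewrite /lower /= -cube_vec Q_vec s1_vec. Qed.

Lemma outside_vec a b c : (cube R `&` outside) (vec a b c) <->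
  [/\ 0 < a <= 1 / 2, 0 < b <= 1 / 2 & 0 < c <= 1 / 2] /\ 0 < Qc a b c.
Proof. by rewrite /outside /= -cube_vec Q_vec. Qed.

(** From a sorted point, raise [c] to [b], lower [a] to [b], then follow the diagonal up to the
    corner. *)
Lemma connected_upper : connected (cube R `&` upper).
Proof.
have diag b : 1 / 4 < b <= 1 / 2 -> (cube R `&` upper) (vec b b b).
  move=> b4; apply/upper_vec; split; first by split; lra.
  by split; [apply: Qc_diag_lt0; [lra|apply/eqP; lra]|lra].
apply: (@connected_symmetric _ (1 / 2) (1 / 2) (1 / 2)).
- move=> a b c /upper_vec[[ha hb hc] [q s]]; apply/upper_vec.
  by rewrite Qc_swap01 (addrC b).
- move=> a b c /upper_vec[[ha hb hc] [q s]]; apply/upper_vec.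
  by rewrite Qc_swap12 addrAC.
- by apply: connected_component_refl; apply: diag; lra.
- by apply: connected_component_refl; apply: diag; lra.
move=> a b c cb ba /upper_vec[[ha hb hc] [q s]].
apply: connected_component_sym.
have raise c' : c <= c' <= b -> Qc a b c' < 0.
  move=> /andP[]; rewrite le_eqVlt => /orP[/eqP <-//|cc] c'b.
  by apply: (@Qc_raise _ a b c); lra.
have [b4 low] : 1 / 4 < b /\ forall a', b <= a' <= a -> Qc a' b b < 0.
  have qb : Qc a b b < 0 by apply: raise; rewrite cb lexx.
  split; first by have [] := @Qc_wall_lt_lower _ a b b; lra.
  by move=> a' ba'; have [] := @Qc_wall_lt_lower _ a a' b; lra.
apply: (@connected_component_trans _ _ (vec a b b)).
  apply: component_segment => u t u0 t0 ut; apply/upper_vec.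
  rewrite !(conv_id _ ut).
  have h1 := conv_itv u0 t0 ut hc hb.
  have := conv_le u0 t0 (lexx c) cb; have := conv_le u0 t0 cb (lexx b).
  rewrite !(conv_id _ ut) => h2 h3.
  by split; [split|split; [apply: raise; rewrite h3|lra]].
apply: (@connected_component_trans _ _ (vec b b b)).
  apply: component_segment => u t u0 t0 ut; apply/upper_vec.
  rewrite !(conv_id _ ut).
  have h1 := conv_itv u0 t0 ut ha hb.
  have := conv_le u0 t0 (lexx a) ba; have := conv_le u0 t0 ba (lexx b).
  rewrite !(conv_id _ ut) => h2 h3.
  by split; [split|split; [apply: low; rewrite h2|lra]].
apply: component_segment => u t u0 t0 ut; apply: diag.
have h2 : b <= 1 / 2 by lra.
have := conv_le u0 t0 (lexx b) h2; have := conv_le u0 t0 h2 (lexx (1 / 2)).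
by rewrite !(conv_id _ ut); lra.
Qed.

(** Shrinking along the ray keeps [Q < 0] and leads into [s1 <= 1/2], where [Q < 0] throughout the
    convex set of sorted positive triples. *)
Lemma connected_lower : connected (cube R `&` lower).
Proof.
have small a b c : 0 < c <= b -> b <= a -> a + b + c <= 1 / 2 ->
    (cube R `&` lower) (vec a b c).
  move=> cb ba s; apply/lower_vec; split; first by split; lra.
  by split; [exact: Qc_small_lt0|lra].
apply: (@connected_symmetric _ (1 / 6) (1 / 6) (1 / 6)).
- move=> a b c /lower_vec[[ha hb hc] [q s]]; apply/lower_vec.
  by rewrite Qc_swap01 (addrC b).
- move=> a b c /lower_vec[[ha hb hc] [q s]]; apply/lower_vec.
  by rewrite Qc_swap12 addrAC.
- by apply: connected_component_refl; apply: small; lra.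
- by apply: connected_component_refl; apply: small; lra.
move=> a b c cb ba /lower_vec[[/andP[a0 a2] /andP[b0 b2] /andP[c0 c2]] [q s]].
apply: connected_component_sym.
(* The factor 2/3 takes [s1 < 3/4] to [s1 < 1/2]. *)
apply: (@connected_component_trans _ _ (vec (2 / 3 * a) (2 / 3 * b) (2 / 3 * c))).
  apply: component_segment => u t u0 t0 ut; apply/lower_vec.
  have [l le] : exists l : R, l = u + t * (2 / 3) by exists (u + t * (2 / 3)).
  have lE x : u * x + t * (2 / 3 * x) = l * x by rewrite le; ring.
  rewrite !lE -!mulrDr.
  have l0 : 0 < l by lra.
  have l1 : l <= 1 by lra.
  have lx x : 0 < x -> 0 < l * x <= x by move=> x0; rewrite mulr_gt0//= ger_pMl.
  have sl : l * (a + b + c) < 3 / 4.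
    by apply: le_lt_trans s; rewrite ger_pMl//; lra.
  have la := lx _ a0; have lb := lx _ b0; have lc := lx _ c0.
  split; first by split; lra.
  split => //; have [->|ln1] := eqVneq l 1; first by rewrite !mul1r.
  apply: Qc_scale => //; [lra| |exact: ltW].
  by left; split; [rewrite lt_neqAle ln1|exact: ltW].
apply: component_segment => u t u0 t0 ut.
have c0' : 0 < 2 / 3 * c by rewrite mulr_gt0//; lra.
have p0 : 0 < 1 / 6 :> R by lra.
have cb' : 2 / 3 * c <= 2 / 3 * b by lra.
have ba' : 2 / 3 * b <= 2 / 3 * a by lra.
have s' : 2 / 3 * a + 2 / 3 * b + 2 / 3 * c <= 1 / 2 by lra.
have := conv_le u0 t0 s' (lexx (1 / 2)); rewrite (conv_id _ ut) => h1.
have := conv_lt u0 t0 ut c0' p0; rewrite (conv_id _ ut) => h2.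
have h3 := conv_le u0 t0 cb' (lexx (1 / 6)).
have h4 := conv_le u0 t0 ba' (lexx (1 / 6)).
apply: small => //; first by rewrite h2.
by apply: le_trans h1; rewrite !mulrDr; lra.
Qed.

(** Contrapositive of [Qc_scale] for the factor [l^-1]: moving along a ray toward the plane
    [s1 = 3/4], without crossing it, keeps [Q > 0]. *)
Lemma Qc_scale_gt0 l a b c : 0 <= c <= b -> b <= a -> 0 < b -> 0 < l ->
  (1 <= l /\ l * (a + b + c) <= 3 / 4) \/
  (l <= 1 /\ 3 / 4 <= l * (a + b + c)) ->
  0 < Qc a b c -> 0 < Qc (l * a) (l * b) (l * c).
Proof.
move=> /andP[c0 cb] ba b0 l0 ls Q0.
have [->|ln1] := eqVneq l 1; first by rewrite !mul1r.
rewrite ltNge; apply/negP => Ql.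
have lx x : l^-1 * (l * x) = x by rewrite mulKf// gt_eqF.
have : Qc (l^-1 * (l * a)) (l^-1 * (l * b)) (l^-1 * (l * c)) < 0.
  apply: Qc_scale => //.
  - by rewrite mulr_ge0//= ?ler_pM2l// ltW.
  - by rewrite ler_pM2l.
  - by rewrite mulr_gt0.
  - by rewrite invr_gt0.
  - rewrite -!mulrDr; case: ls => -[l1 ls]; [left|right]; split=> //.
      by rewrite invf_lt1// lt_neqAle eq_sym ln1.
    by rewrite invf_gt1// lt_neqAle ln1.
by rewrite !lx ltNge ltW.
Qed.

Lemma plane_outside a b c : 0 < c <= b -> b <= a -> a <= 1 / 2 ->
  a + b + c = 3 / 4 -> 1 / 4 < a -> (cube R `&` outside) (vec a b c).
Proof.
move=> cb ba a2 s a4; apply/outside_vec; split; first by split; lra.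
by apply: Qc_mid_plane_gt0 => //; [lra|lra|apply/eqP; lra].
Qed.

Lemma face_outside b c : 0 < c <= b -> b + c <= 1 / 4 ->
  (cube R `&` outside) (vec (1 / 2) b c).
Proof.
move=> cb bc; apply/outside_vec; split; first by split; lra.
by apply: Qc_face_gt0; lra.
Qed.

Lemma plane_component a b c a' b' c' :
  0 < c <= b -> b <= a -> a <= 1 / 2 -> a + b + c = 3 / 4 -> 1 / 4 < a ->
  0 < c' <= b' -> b' <= a' -> a' <= 1 / 2 -> a' + b' + c' = 3 / 4 -> 1 / 4 < a' ->
  connected_component (cube R `&` outside) (vec a b c) (vec a' b' c').
Proof.
move=> /andP[c0 cb] ba a2 s a4 /andP[c0' cb'] ba' a2' s' a4'.
apply: component_segment => u t u0 t0 ut.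
apply: plane_outside.
- by rewrite (conv_le u0 t0 cb cb') -[ltLHS](conv_id 0 ut) conv_lt.
- exact: conv_le.
- by rewrite -[leRHS](conv_id (1 / 2) ut); exact: conv_le.
- have : u * (a + b + c) + t * (a' + b' + c') = 3 / 4 by rewrite s s' conv_id.
  by move=> <-; ring.
- by rewrite -[ltLHS](conv_id (1 / 4) ut); exact: conv_lt.
Qed.

Lemma face_component b c b' c' :
  0 < c <= b -> b + c <= 1 / 4 -> 0 < c' <= b' -> b' + c' <= 1 / 4 ->
  connected_component (cube R `&` outside) (vec (1 / 2) b c) (vec (1 / 2) b' c').
Proof.
move=> /andP[c0 cb] s /andP[c0' cb'] s'.
apply: component_segment => u t u0 t0 ut; rewrite (conv_id _ ut).
apply: face_outside.
- by rewrite (conv_le u0 t0 cb cb') -[ltLHS](conv_id 0 ut) conv_lt.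
- have := conv_le u0 t0 s s'; rewrite (conv_id _ ut).
  by apply: le_trans; rewrite !mulrDr; lra.
Qed.

Lemma ray_component l a b c : 0 < c <= b -> b <= a -> a <= 1 / 2 ->
  0 < l -> l * a <= 1 / 2 ->
  (1 <= l /\ l * (a + b + c) <= 3 / 4) \/
    (l <= 1 /\ 3 / 4 <= l * (a + b + c)) -> 0 < Qc a b c ->
  connected_component (cube R `&` outside) (vec a b c)
    (vec (l * a) (l * b) (l * c)).
Proof.
move=> /andP[c0 cb] ba a2 l0 la ls q; apply: component_segment => u t u0 t0 ut.
have [m me] : exists m : R, m = u + t * l by exists (u + t * l).
have mE x : u * x + t * (l * x) = m * x by rewrite me; ring.
have ma : u * a + t * (l * a) <= 1 / 2.
  by rewrite -[leRHS](conv_id (1 / 2) ut); exact: conv_le.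
have m0 : 0 < m.
  by have := conv_lt u0 t0 ut ltr01 l0; rewrite !mulr0 mulr1 addr0 me.
have s0 : 0 < a + b + c by lra.
have ms : (1 <= m /\ m * (a + b + c) <= 3 / 4) \/
    (m <= 1 /\ 3 / 4 <= m * (a + b + c)).
  case: ls => -[l1 ls]; [left|right].
    have ml : m <= l.
      by have := conv_le u0 t0 l1 (lexx l); rewrite (conv_id _ ut) mulr1 me.
    split; last by apply: le_trans ls; rewrite ler_pM2r.
    by have := conv_le u0 t0 (lexx 1) l1; rewrite (conv_id _ ut) mulr1 me.
  have ml : l <= m.
    by have := conv_le u0 t0 l1 (lexx l); rewrite (conv_id _ ut) mulr1 me.
  split; last by apply: (le_trans ls); rewrite ler_pM2r.
  by have := conv_le u0 t0 (lexx 1) l1; rewrite (conv_id _ ut) mulr1 me.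
rewrite mE in ma; rewrite !mE.
have mcb : m * c <= m * b by rewrite ler_pM2l.
have mba : m * b <= m * a by rewrite ler_pM2l.
have mc0 : 0 < m * c by rewrite mulr_gt0.
apply/outside_vec; split; first by split; apply/andP; split; lra.
by apply: Qc_scale_gt0 => //; lra.
Qed.

Lemma Qc_center : Qc (1 / 4) (1 / 4) (1 / 4) = 0 :> R.
Proof.
rewrite Qc_wall (_ : wall_coef _ _ = 0) ?expr0n ?mul0r ?mulr0//.
by rewrite /wall_coef /kappa; field.
Qed.

(** A sorted point follows its ray to the plane [s1 = 3/4], or to the face [a = 1/2] if it meets
    that first. The base point lies on both, and the sorted part of each is convex. *)
Lemma connected_outside : connected (cube R `&` outside).
Proof.
have C01 a b c : (cube R `&` outside) (vec a b c) ->
    (cube R `&` outside) (vec b a c).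
  move=> /outside_vec[[ha hb hc] q]; apply/outside_vec.
  by rewrite Qc_swap01.
apply: (@connected_symmetric _ (1 / 2) (1 / 8) (1 / 8)) => //.
- move=> a b c /outside_vec[[ha hb hc] q]; apply/outside_vec.
  by rewrite Qc_swap12.
(* The point (1/3, 1/3, 1/12) of the plane is fixed by the swap, so it links the base point to its
   image. *)
- have h : connected_component (cube R `&` outside)
      (vec (1 / 2) (1 / 8) (1 / 8)) (vec (1 / 3) (1 / 3) (1 / 12)).
    by apply: plane_component; lra.
  apply: (connected_component_trans h); apply: connected_component_sym.
  have := connected_component_image continuous_swap01 _ h.
  by rewrite /swap01 !vecE; apply => v; rewrite -{1}(vecK v); exact: C01.
- by apply: connected_component_refl; apply: plane_outside; lra.
move=> a b c cb ba /outside_vec[[/andP[a0 a2] /andP[b0 _] /andP[c0 _]] q].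
apply: connected_component_sym.
have cb' : 0 < c <= b by rewrite c0.
have s0 : 0 < a + b + c by rewrite !addr_gt0.
have [l l0 ls] : exists2 l, 0 < l & l * (a + b + c) = 3 / 4.
  exists (3 / 4 / (a + b + c)); first by rewrite divr_gt0//; lra.
  by field; rewrite gt_eqF.
have to_plane : l * a <= 1 / 2 -> connected_component (cube R `&` outside) (vec a b c)
      (vec (1 / 2) (1 / 8) (1 / 8)).
  move=> la.
  have l1 : (1 <= l /\ l * (a + b + c) <= 3 / 4) \/
      (l <= 1 /\ 3 / 4 <= l * (a + b + c)).
    by rewrite ls; case: (lerP 1 l) => [|/ltW] l1; [left|right].
  apply: connected_component_trans (ray_component cb' ba a2 l0 la l1 q) _.
  have ql : 0 < Qc (l * a) (l * b) (l * c).
    by apply: Qc_scale_gt0 => //; rewrite (ltW c0).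
  rewrite !mulrDr in ls.
  have lc0 : 0 < l * c by rewrite mulr_gt0.
  have lcb : l * c <= l * b by rewrite ler_pM2l.
  have lba : l * b <= l * a by rewrite ler_pM2l.
  apply: plane_component => //; rewrite ?lc0//; try lra.
  (* Equality would put the ray's end at the centre, where Q vanishes. *)
  rewrite lt_neqAle; apply/andP; split; last lra.
  apply/eqP => a4; move: ql; rewrite -a4.
  have -> : l * b = 1 / 4 by lra.
  have -> : l * c = 1 / 4 by lra.
  by rewrite Qc_center ltxx.
case: (lerP (l * a) (1 / 2)) => [/to_plane//|la].
case: (lerP (3 / 4) (a + b + c)) => s34.
  apply: to_plane; apply: le_trans a2; rewrite ger_pMl//.
  by rewrite -(ler_pM2r s0) ls mul1r.
(* The ray leaves the cube before the plane, so it is followed only to the face. *)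
have [m m0 ma] : exists2 m, 0 < m & m * a = 1 / 2.
  exists (1 / 2 / a); first by rewrite divr_gt0//; lra.
  by field; rewrite gt_eqF.
have ml : m <= l by rewrite -(ler_pM2r a0) ma ltW.
have ms : m * (a + b + c) <= 3 / 4 by rewrite -ls ler_pM2r.
have m1 : 1 <= m by rewrite -(ler_pM2r a0) ma; lra.
have ma' : m * a <= 1 / 2 by rewrite ma.
apply: (connected_component_trans
  (ray_component cb' ba a2 m0 ma' (or_introl (conj m1 ms)) q)).
have mc0 : 0 < m * c by rewrite mulr_gt0.
have mcb : m * c <= m * b by rewrite ler_pM2l.
rewrite !mulrDr ma in ms; rewrite ma.
by apply: face_component; lra.
Qed.
End Regions.

(** * Connectedness of Omega *)

Section OmegaConnected.
Variable R : realType.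
Implicit Types a b c r s t u x : R.

Lemma ivt_zero (f : R -> R) x y : x <= y -> continuous f ->
  f x <= 0 <= f y \/ f y <= 0 <= f x -> exists2 s, x <= s <= y & f s = 0.
Proof.
move=> xy cf fxy.
have [||s] := @IVT R f x y 0 xy; first exact: continuous_subspaceT.
- by case: fxy => /andP[f1 f2]; rewrite ge_min le_max f1 f2 ?orbT.
- by rewrite in_itv /= => ? ?; exists s.
Qed.

Lemma Qc_plane_ge0 a b c : 0 < a -> 0 < b -> 0 < c -> a + b + c = 3 / 4 ->
  0 <= Qc a b c.
Proof.
move: a b c; apply: sorted_ind => [a b c h b0 a0 c0 s|a b c h a0 c0 b0 s|].
- by rewrite Qc_swap01; apply: h => //; lra.
- by rewrite Qc_swap12; apply: h => //; lra.
move=> a b c cb ba a0 b0 c0 s; have [a4|a4] := eqVneq a (1 / 4).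
  have -> : b = 1 / 4 by lra.
  have -> : c = 1 / 4 by lra.
  by rewrite a4 Qc_center.
by apply: ltW; apply: Qc_mid_plane_gt0 => //; lra.
Qed.

(** A zero with [a > 1/2] could be scaled down to the face [a = 1/2] and would give [Q < 0] there,
    against [Qc_face_gt0]. Hence the whole graph over the open simplex lies in the cube. *)
Lemma Omega_le_half a b c : 0 < a -> 0 < b -> 0 < c -> a + b + c <= 3 / 4 ->
  Qc a b c = 0 -> [/\ a <= 1 / 2, b <= 1 / 2 & c <= 1 / 2].
Proof.
move: a b c; apply: sorted_ind => [a b c h b0 a0 c0 s|a b c h a0 c0 b0 s|].
- by rewrite Qc_swap01 => q; have [|h1 h2 h3] := h a0 b0 c0 _ q; [lra|split].
- by rewrite Qc_swap12 => q; have [|h1 h2 h3] := h a0 b0 c0 _ q; [lra|split].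
move=> a b c cb ba a0 b0 c0 s q.
suff : a <= 1 / 2 by split; lra.
rewrite leNgt; apply/negP => a2.
have [l l0 la] : exists2 l, 0 < l & l * a = 1 / 2.
  exists (1 / 2 / a); first by rewrite divr_gt0//; lra.
  by field; rewrite gt_eqF.
have l1 : l < 1 by rewrite -(ltr_pM2r a0); lra.
have s0 : 0 < a + b + c by lra.
have ls : l * (a + b + c) <= 3 / 4 by apply: le_trans s; rewrite ger_pMl// ltW.
have : Qc (l * a) (l * b) (l * c) < 0.
  by apply: Qc_scale => //; [rewrite ltW|left|rewrite q].
have lb0 : 0 < l * b by rewrite mulr_gt0.
have lc0 : 0 < l * c by rewrite mulr_gt0.
have lcb : l * c <= l * b by rewrite ler_pM2l.
rewrite !mulrDr la in ls; rewrite la ltNge => /negP; apply.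
by apply: ltW; apply: Qc_face_gt0; lra.
Qed.

Lemma Qc_origin : Qc 0 0 0 < 0 :> R.
Proof.
have -> : Qc 0 0 0 = - 1 :> R by rewrite /Qc /Q_sym; ring.
by rewrite oppr_lt0.
Qed.

(** Q is -1 at the origin and nonnegative on the plane, which yields a zero; [Qc_scale] fixes the
    strict signs on either side of it. *)
Lemma ray_fiber a b c : 0 < a -> 0 < b -> 0 < c -> a + b + c = 3 / 4 ->
  exists s, [/\ 0 <= s <= 1, Qc (s * a) (s * b) (s * c) = 0,
    forall r, 0 <= r < s -> Qc (r * a) (r * b) (r * c) < 0 &
    forall r, s < r <= 1 -> 0 < Qc (r * a) (r * b) (r * c)].
Proof.
move: a b c; apply: sorted_ind => [a b c h b0 a0 c0 s|a b c h a0 c0 b0 s|].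
- have [|t [t1 qt ht1 ht2]] := h a0 b0 c0; first lra.
  exists t; split; [exact: t1|by rewrite Qc_swap01|move=> r tr..].
    by rewrite Qc_swap01; exact: ht1.
  by rewrite Qc_swap01; exact: ht2.
- have [|t [t1 qt ht1 ht2]] := h a0 b0 c0; first lra.
  exists t; split; [exact: t1|by rewrite Qc_swap12|move=> r tr..].
    by rewrite Qc_swap12; exact: ht1.
  by rewrite Qc_swap12; exact: ht2.
move=> a b c cb ba a0 b0 c0 s.
have down r r' : 0 < r' < r -> r <= 1 -> Qc (r * a) (r * b) (r * c) <= 0 ->
    Qc (r' * a) (r' * b) (r' * c) < 0.
  move=> /andP[r'0 r'r] r1 qr.
  have r0 : 0 < r by exact: lt_trans r'r.
  have e x : r' * x = r' / r * (r * x) by field; rewrite gt_eqF.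
  rewrite (e a) (e b) (e c); apply: Qc_scale => //.
  - by rewrite ler_pM2l// cb andbT ltW// mulr_gt0.
  - by rewrite ler_pM2l.
  - by rewrite mulr_gt0.
  - by rewrite divr_gt0.
  - by left; rewrite ltr_pdivrMr// mul1r -!mulrDr s; split => //; lra.
have [|||t /andP[t0 t1] qt] :=
  @ivt_zero (fun r => Qc (r * a) (r * b) (r * c)) 0 1.
- by rewrite ler01.
- by apply: continuous_Qc; continuity.
- left; rewrite !mul0r !mul1r (ltW Qc_origin).
  exact: Qc_plane_ge0.
exists t; split; rewrite ?t0// => r /andP[r1 r2].
(* [Qc_scale] asks for a positive ratio, so the origin is treated by its value. *)
- have [->|rn0] := eqVneq r 0; first by rewrite !mul0r Qc_origin.
  by apply: (down t) => //; rewrite ?qt// r2 lt_neqAle eq_sym rn0 r1.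
- rewrite ltNge; apply/negP => qr.
  have tn0 : t != 0.
    by apply: contra_eq_neq qt => ->; rewrite !mul0r lt_eqF ?Qc_origin.
  have : Qc (t * a) (t * b) (t * c) < 0.
    by apply: (down r) => //; rewrite r1 lt_neqAle eq_sym tn0 t0.
  by rewrite qt ltxx.
Qed.

Definition ray_base : set 'rV[R]_3 :=
  [set v : 'rV[R]_3 | [/\ 0 < v 0 0, 0 < v 0 1, 0 < v 0 2 & s1 v = 3 / 4]].

Lemma connected_ray_base : connected ray_base.
Proof.
apply: (@connected_of_component _ _ (vec (1 / 4) (1 / 4) (1 / 4))) => v.
rewrite -(vecK v); move: (v 0 0) (v 0 1) (v 0 2) => a b c.
rewrite /ray_base /= s1_vec !vecE => -[a0 b0 c0 s].
have q0 : 0 < 1 / 4 :> R by lra.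
apply: component_segment => u t u0 t0 ut /=; rewrite s1_vec !vecE.
have ca := conv_lt u0 t0 ut q0 a0; have cb := conv_lt u0 t0 ut q0 b0.
have cc := conv_lt u0 t0 ut q0 c0; rewrite !(conv_id 0 ut) in ca cb cc.
split => //.
have -> : u * (1 / 4) + t * a + (u * (1 / 4) + t * b) + (u * (1 / 4) + t * c) =
  u * (3 / 4) + t * (a + b + c) by field.
by rewrite s conv_id.
Qed.

Definition Omega_low : set 'rV[R]_3 :=
  Omega R `&` ((fun us : 'rV[R]_3 * R => us.2 *: us.1) @`
    (ray_base `*` `[0, 1]%classic)).

Lemma open_Q_lt0 : open [set v : 'rV[R]_3 | Q v < 0].
Proof.
apply: (@open_comp _ _ (@Q R) [set x | x < 0]); last exact: open_lt.
by move=> v _; exact: continuous_Q.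
Qed.

Lemma open_Q_gt0 : open [set v : 'rV[R]_3 | 0 < Q v].
Proof.
apply: (@open_comp _ _ (@Q R) [set x | 0 < x]); last exact: open_gt.
by move=> v _; exact: continuous_Q.
Qed.

Lemma open_s1_lt x : open [set v : 'rV[R]_3 | s1 v < x].
Proof.
apply: (@open_comp _ _ (@s1 R) [set y | y < x]); last exact: open_lt.
by move=> v _; exact: continuous_s1.
Qed.

Lemma open_s1_gt x : open [set v : 'rV[R]_3 | x < s1 v].
Proof.
apply: (@open_comp _ _ (@s1 R) [set y | x < y]); last exact: open_gt.
by move=> v _; exact: continuous_s1.
Qed.

Lemma connected_Omega_low : connected Omega_low.
Proof.
apply: (@connected_graph R _ _ ray_base _ _ [set v | Q v < 0] [set v | 0 < Q v]).
- exact: connected_ray_base.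
- by move=> p; apply: cvgZ; [exact: cvg_snd|exact: cvg_fst].
- exact: open_Q_lt0.
- exact: open_Q_gt0.
- by rewrite -subset0 => v [/= ->]; rewrite ltxx.
- by rewrite -subset0 => v [/= ->]; rewrite ltxx.
- by rewrite -subset0 => v [/= q1 q2]; have := lt_trans q1 q2; rewrite ltxx.
move=> v; rewrite -(vecK v); move: (v 0 0) (v 0 1) (v 0 2) => a b c.
rewrite /ray_base /= s1_vec !vecE => -[a0 b0 c0 s].
have [t [t01 qt h1 h2]] := ray_fiber a0 b0 c0 s.
by exists t; split => [//||r rt|r rt];
  rewrite /Omega /= scale_vec Q_vec; [exact: qt|exact: h1|exact: h2].
Qed.

Lemma sub_Omega_low : Omega_low `<=` cube R `&` Omega R.
Proof.
move=> v [Ov [[w t] [Bw t01] wv]]; rewrite /= in wv; rewrite -{v}wv in Ov *.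
rewrite /= in_itv /= in t01; move: Bw Ov; rewrite -(vecK w).
move: (w 0 0) (w 0 1) (w 0 2) => a b c.
rewrite /ray_base /= s1_vec !vecE => -[a0 b0 c0 s] Ov.
split=> //; move: Ov; rewrite /Omega /= scale_vec Q_vec => qt.
case/andP: t01 => t0 t1.
have {}t0 : 0 < t.
  rewrite lt_neqAle t0 andbT eq_sym.
  by apply: contra_eq_neq qt => ->; rewrite !mul0r lt_eqF ?Qc_origin.
have [ta tb tc] : [/\ 0 < t * a, 0 < t * b & 0 < t * c] by rewrite !mulr_gt0.
have ts : t * a + t * b + t * c <= 3 / 4 by rewrite -!mulrDr s ger_pMl//; lra.
have [ha hb hc] := Omega_le_half ta tb tc ts qt.
by apply/cube_vec; rewrite ta tb tc.
Qed.

Lemma Omega_low_mem a b c : 0 < a -> 0 < b -> 0 < c -> a + b + c <= 3 / 4 ->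
  Qc a b c = 0 -> Omega_low (vec a b c).
Proof.
move=> a0 b0 c0 s q; split; first by rewrite /Omega /= Q_vec.
have s0 : 0 < a + b + c by lra.
have [l l0 ls] : exists2 l, 0 < l & l * (a + b + c) = 3 / 4.
  exists (3 / 4 / (a + b + c)); first by rewrite divr_gt0//; lra.
  by field; rewrite gt_eqF.
exists (vec (l * a) (l * b) (l * c), l^-1) => /=; last first.
  by rewrite -scale_vec scalerA mulVf ?scale1r// gt_eqF.
split.
  by rewrite /ray_base /= s1_vec !vecE -!mulrDr !mulr_gt0.
rewrite /= in_itv /= invr_ge0 ltW//= invf_le1// -(ler_pM2r s0) mul1r; lra.
Qed.

(* [v] stands for the pair of its first two coordinates. *)
Definition wall_base : set 'rV[R]_3 :=
  [set v : 'rV[R]_3 | [/\ 0 < v 0 1 <= v 0 0, v 0 0 <= 1 / 2, v 0 2 = v 0 1,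
    3 / 4 <= v 0 0 + v 0 1 + v 0 1 & Qc (v 0 0) (v 0 1) (v 0 1) <= 0]].

Lemma wall_base_vec a b c : wall_base (vec a b c) <->
  [/\ 0 < b <= a, a <= 1 / 2, c = b, 3 / 4 <= a + b + b & Qc a b b <= 0].
Proof. by rewrite /wall_base /= !vecE. Qed.

Lemma Qc_diag_le0 b : 0 < b -> Qc b b b <= 0.
Proof.
move=> b0; have [->|b4] := eqVneq b (1 / 4); first by rewrite Qc_center.
exact/ltW/Qc_diag_lt0.
Qed.

(** Lowering [a] to [b] stays in the set, and the diagonal then leads down to [b = 1/4]. *)
Lemma connected_wall_base : connected wall_base.
Proof.
apply: (@connected_of_component _ _ (vec (1 / 4) (1 / 4) (1 / 4))) => v.
rewrite -(vecK v); move: (v 0 0) (v 0 1) (v 0 2) => a b c.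
move=> /wall_base_vec[/andP[b0 ba] a2 -> s q].
have lower_wall a' : b <= a' <= a -> 1 / 4 <= b /\ Qc a' b b <= 0.
  by move=> /andP[ba' a'a]; apply: (@Qc_wall_le_lower _ a); rewrite ?b0.
have [|b4 _] := lower_wall b; first by rewrite lexx.
apply: connected_component_sym.
apply: (@connected_component_trans _ _ (vec b b b)).
  apply: component_segment => u t u0 t0 ut; apply/wall_base_vec.
  rewrite !(conv_id _ ut).
  have := conv_le u0 t0 (lexx a) ba; have := conv_le u0 t0 ba (lexx b).
  rewrite !(conv_id _ ut) => h1 h2.
  have [|_ q'] := lower_wall (u * a + t * b); first by rewrite h1.
  by split => //; lra.
apply: component_segment => u t u0 t0 ut; apply/wall_base_vec.
have := conv_le u0 t0 (lexx b) b4; have := conv_le u0 t0 b4 (lexx (1 / 4)).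
rewrite !(conv_id _ ut) => h1 h2.
by split => //; [lra|lra|lra|apply: Qc_diag_le0; lra].
Qed.

(** Q changes sign as the third coordinate rises to [b] within [s1 >= 3/4], and [Qc_raise] makes the
    crossing unique there. *)
Lemma wall_fiber a b : 0 < b <= a -> a <= 1 / 2 -> 3 / 4 <= a + b + b ->
  Qc a b b <= 0 -> exists s, [/\ 0 <= s <= 1,
    Qc a b (s * b) = 0 /\ 3 / 4 <= a + b + s * b,
    forall r, 0 <= r < s -> 0 < Qc a b (r * b) \/ a + b + r * b < 3 / 4 &
    forall r, s < r <= 1 -> Qc a b (r * b) < 0 /\ 3 / 4 < a + b + r * b].
Proof.
move=> /andP[b0 ba] a2 sab q.
have up r r' : 0 <= r < r' -> r' <= 1 -> 3 / 4 <= a + b + r * b ->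
    Qc a b (r * b) <= 0 -> Qc a b (r' * b) < 0.
  move=> /andP[r0 rr'] r1 sr qr; apply: (@Qc_raise _ a b (r * b)) => //.
    by rewrite mulr_ge0 ?ltr_pM2r// ltW.
  by rewrite ger_pMl.
(* The fibre enters [s1 >= 3/4] either at height 0, on the floor, or on the plane [s1 = 3/4]; both
   have [Q >= 0]. *)
have [z [z0 z1 sz qz]] : exists z, [/\ 0 <= z, z <= 1,
    3 / 4 <= a + b + z * b & 0 <= Qc a b (z * b)].
  have [s0|s0] := leP (3 / 4) (a + b).
    exists 0; rewrite mul0r addr0 lexx ler01; split => //.
    by apply: ltW; apply: Qc_floor_gt0; lra.
  have ze : (3 / 4 - a - b) / b * b = 3 / 4 - a - b by field; rewrite gt_eqF.
  exists ((3 / 4 - a - b) / b); rewrite ze; split.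
  - by rewrite divr_ge0//; lra.
  - by rewrite ler_pdivrMr//; lra.
  - lra.
  - by apply: Qc_plane_ge0; lra.
have [|||s /andP[zs s1] qs] := @ivt_zero (fun r => Qc a b (r * b)) z 1 => //.
- by apply: continuous_Qc; continuity.
- by right; rewrite mul1r qz q.
have zsb : z * b <= s * b by rewrite ler_pM2r.
have ss : 3 / 4 <= a + b + s * b by lra.
have s0 : 0 <= s by exact: le_trans zs.
exists s; split; [by rewrite s0|by []| |].
- move=> r /andP[r0 rs]; have [sr|sr] := leP (3 / 4) (a + b + r * b); last by right.
  left; rewrite ltNge; apply/negP => qr.
  by have := up r s; rewrite r0 rs qs ltxx => /(_ isT s1 sr qr).
- move=> r /andP[sr r1]; split.
    by apply: (up s); rewrite ?s0 ?qs.
  have : s * b < r * b by rewrite ltr_pM2r.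
  lra.
Qed.

Definition Omega_high : set 'rV[R]_3 :=
  [set v | Q v = 0 /\ 3 / 4 <= s1 v] `&`
  ((fun vs : 'rV[R]_3 * R => vec (vs.1 0 0) (vs.1 0 1) (vs.2 * vs.1 0 1)) @`
    (wall_base `*` `[0, 1]%classic)).

Lemma connected_Omega_high : connected Omega_high.
Proof.
(* Below the crossing the fibre may drop under [s1 = 3/4], where [wall_fiber] gives no sign of Q, so
   the lower open set includes [s1 < 3/4]. *)
apply: (@connected_graph R _ _ wall_base _ _
  ([set v | 0 < Q v] `|` [set v | s1 v < 3 / 4])
  ([set v | Q v < 0] `&` [set v | 3 / 4 < s1 v])).
- exact: connected_wall_base.
- have cc i : continuous (fun p : 'rV[R]_3 * R => p.1 0 i).
    move=> p; apply: (@cvg_comp _ _ _ fst (fun v : 'rV[R]_3 => v 0 i) _ (nbhs p.1)).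
      exact: cvg_fst.
    exact: continuous_coord.
  apply: continuous_vec; [exact: cc|exact: cc|apply: continuous_mul; last exact: cc].
  by move=> p; exact: cvg_snd.
- by apply: openU; [exact: open_Q_gt0|exact: open_s1_lt].
- by apply: openI; [exact: open_Q_lt0|exact: open_s1_gt].
- by rewrite -subset0 => v [/= [-> s] []]; rewrite ?ltxx// ltNge s.
- by rewrite -subset0 => v [/= [-> s] []]; rewrite ltxx.
- rewrite -subset0 => v [/= [q|s] [q' s']].
    by have := lt_trans q q'; rewrite ltxx.
  by have := lt_trans s s'; rewrite ltxx.
move=> v; rewrite -(vecK v); move: (v 0 0) (v 0 1) (v 0 2) => a b c.
move=> /wall_base_vec[ba a2 _ s q].
have [t [t01 qt h1 h2]] := wall_fiber ba a2 s q.
by exists t; split => [//||r rt|r rt]; rewrite /= Q_vec s1_vec !vecE;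
  [exact: qt|exact: h1|exact: h2].
Qed.

Lemma sub_Omega_high : Omega_high `<=` cube R `&` Omega R.
Proof.
move=> v [[q s] [[w t] [Bw t01] wv]]; rewrite /= in wv; rewrite -{v}wv in q s *.
rewrite /= in_itv /= in t01; move: Bw q s; rewrite -(vecK w).
move: (w 0 0) (w 0 1) (w 0 2) => a b c.
rewrite !vecE Q_vec s1_vec => /wall_base_vec[/andP[b0 ba] a2 _ s q] qt st.
split; last by rewrite /Omega /= Q_vec.
case/andP: t01 => t0 t1.
have {}t0 : 0 < t.
  rewrite lt_neqAle t0 andbT eq_sym; apply/eqP => t00.
  move: qt st; rewrite t00 mul0r addr0 => qt st.
  have : 0 < Qc a b 0 by apply: Qc_floor_gt0; lra.
  by rewrite qt ltxx.
have tb0 : 0 < t * b by rewrite mulr_gt0.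
have tb1 : t * b <= b by rewrite ger_pMl.
by apply/cube_vec; split; lra.
Qed.

Lemma Omega_high_mem a b c : 0 < c <= b -> b <= a -> a <= 1 / 2 ->
  3 / 4 <= a + b + c -> Qc a b c = 0 -> Omega_high (vec a b c).
Proof.
move=> /andP[c0 cb] ba a2 s q.
have b0 : 0 < b by exact: lt_le_trans cb.
split; first by rewrite /= Q_vec s1_vec.
exists (vec a b b, c / b) => /=; last first.
  by rewrite !vecE; congr vec; field; rewrite gt_eqF.
split; last first.
  rewrite /= in_itv /=; apply/andP; split; first by rewrite divr_ge0// ltW.
  by rewrite ler_pdivrMr// mul1r.
apply/wall_base_vec; split; rewrite ?b0//; first lra.
move: cb; rewrite le_eqVlt => /orP[/eqP e|cb]; first by rewrite -{2}e q.
by apply/ltW; apply: (@Qc_raise _ a b c); rewrite ?q//; lra.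
Qed.

Lemma connected_Omega : connected (cube R `&` Omega R).
Proof.
have mem a b c : (cube R `&` Omega R) (vec a b c) <->
    [/\ 0 < a <= 1 / 2, 0 < b <= 1 / 2 & 0 < c <= 1 / 2] /\ Qc a b c = 0.
  by rewrite /Omega /= -cube_vec Q_vec.
have center : (cube R `&` Omega R) (vec (1 / 4) (1 / 4) (1 / 4)).
  by apply/mem; split; [split; lra|exact: Qc_center].
apply: (@connected_symmetric _ _ (1 / 4) (1 / 4) (1 / 4)).
- by move=> a b c /mem[[ha hb hc] q]; apply/mem; rewrite Qc_swap01.
- by move=> a b c /mem[[ha hb hc] q]; apply/mem; rewrite Qc_swap12.
- exact: connected_component_refl.
- exact: connected_component_refl.
move=> a b c cb ba /mem[[/andP[a0 a2] /andP[b0 b2] /andP[c0 c2]] q].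
have [s|s] := leP (a + b + c) (3 / 4).
  apply: (connected_component_max _ sub_Omega_low connected_Omega_low).
    by apply: Omega_low_mem; rewrite ?Qc_center//; lra.
  exact: Omega_low_mem.
apply: (connected_component_max _ sub_Omega_high connected_Omega_high).
  by apply: Omega_high_mem; rewrite ?Qc_center//; lra.
by apply: Omega_high_mem; rewrite ?c0 ?(ltW s).
Qed.
End OmegaConnected.

(** * The three components of the complement *)

Section Components.
Variable R : realType.

(** A connected subset of [A] through [x] meets [U] in a set both open and closed in it, its
    complement there being cut out by [V]; so it lies in [U]. *)
Lemma connected_component_clopen (T : topologicalType) (A U V : set T) x :
  open U -> open V -> A `<=` U `|` V -> U `&` V = set0 ->
  connected (A `&` U) -> A x -> U x -> connected_component A x = A `&` U.
Proof.
move=> oU oV AUV UV cAU Ax Ux; apply/seteqP; split; last first.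
  by apply: connected_component_max => // y [].
move=> y [C [Cx CA cC] Cy]; split; first exact: CA.
suff CU : C `&` U = C by move: Cy; rewrite -CU => -[].
apply: cC; first by exists x.
  by exists U.
exists (~` V); first exact: open_closedC.
apply/seteqP; split=> z [Cz Uz]; split=> //.
  by move=> Vz; have : (U `&` V) z by []; rewrite UV.
by have [] := AUV z (CA _ Cz).
Qed.

Lemma cube_split (v : 'rV[R]_3) : (cube R `\` Omega R) v ->
  [\/ lower v, upper v | outside v].
Proof.
rewrite -(vecK v); move: (v 0 0) (v 0 1) (v 0 2) => a b c.
rewrite /Omega /lower /upper /outside /= Q_vec s1_vec.
move=> [/cube_vec[/andP[a0 _] /andP[b0 _] /andP[c0 _]] /eqP q0].
have [q|q] := ltP 0 (Qc a b c); first exact: Or33.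
have {q0}q : Qc a b c < 0 by rewrite lt_neqAle q0.
have [s|s|s] := ltgtP (a + b + c) (3 / 4); [exact: Or31|exact: Or32|].
by have := Qc_plane_ge0 a0 b0 c0 s; rewrite leNgt q.
Qed.

Lemma cube_piece (U : set 'rV[R]_3) : (forall v, U v -> Q v != 0) ->
  (cube R `\` Omega R) `&` U = cube R `&` U.
Proof.
move=> UQ; apply/seteqP; split=> v; first by case=> -[].
by move=> [cv Uv]; split=> //; split=> //; apply/eqP; exact: UQ.
Qed.

(** Numbers the components so as to serve as the bijection from [I_3]; every index from 2 on gives
    the third set, hence the bounds [n < 3] below. *)
Definition piece (n : nat) : set 'rV[R]_3 :=
  match n with
  | 0%N => cube R `&` @lower R
  | 1%N => cube R `&` @upper R
  | _ => cube R `&` @outside R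
  end.

Lemma connected_component_piece n v : (n < 3)%N -> piece n v ->
  connected_component (cube R `\` Omega R) v = piece n.
Proof.
have lu : @lower R `&` (@upper R `|` @outside R) = set0.
  rewrite -subset0 => w [[q s] [[_ s']|q']].
    by have := lt_trans s s'; rewrite ltxx.
  by have := lt_trans q q'; rewrite ltxx.
have ul : @upper R `&` (@lower R `|` @outside R) = set0.
  rewrite -subset0 => w [[q s] [[_ s']|q']].
    by have := lt_trans s s'; rewrite ltxx.
  by have := lt_trans q q'; rewrite ltxx.
have ol : @outside R `&` (@lower R `|` @upper R) = set0.
  by rewrite -subset0 => w [q [] [q' _]]; have := lt_trans q q'; rewrite ltxx.
have lQ w : @lower R w -> Q w != 0 by case=> q _; rewrite lt_eqF.
have uQ w : @upper R w -> Q w != 0 by case=> q _; rewrite lt_eqF.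
have oQ w : @outside R w -> Q w != 0 by move=> q; rewrite gt_eqF.
have ol' : open (@lower R) by apply: openI; [exact: open_Q_lt0|exact: open_s1_lt].
have ou' : open (@upper R) by apply: openI; [exact: open_Q_lt0|exact: open_s1_gt].
have oo' : open (@outside R) by exact: open_Q_gt0.
case: n => [|[|[|//]]] _; rewrite /piece.
- rewrite -(cube_piece lQ) => -[Av Uv].
  apply: (connected_component_clopen ol' (openU ou' oo') _ lu) => //.
    by move=> w /cube_split[]; [left|right; left|right; right].
  by rewrite cube_piece//; exact: connected_lower.
- rewrite -(cube_piece uQ) => -[Av Uv].
  apply: (connected_component_clopen ou' (openU ol' oo') _ ul) => //.
    by move=> w /cube_split[]; [right; left|left|right; right].
  by rewrite cube_piece//; exact: connected_upper.
- rewrite -(cube_piece oQ) => -[Av Uv].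
  apply: (connected_component_clopen oo' (openU ol' ou') _ ol) => //.
    by move=> w /cube_split[]; [right; left|right; right|left].
  by rewrite cube_piece//; exact: connected_outside.
Qed.

Lemma piece_sub n : piece n `<=` cube R `\` Omega R.
Proof.
case: n => [|[|n]] v [cv h]; split=> //; rewrite /Omega /=; move: h.
- by case=> q _ /eqP; rewrite lt_eqF.
- by case=> q _ /eqP; rewrite lt_eqF.
- by move=> q /eqP; rewrite gt_eqF.
Qed.

Lemma piece_disjoint n m v : (n < 3)%N -> (m < 3)%N ->
  piece n v -> piece m v -> n = m.
Proof.
case: n m => [|[|[|//]]] [|[|[|//]]] // _ _ [_ h] [_ h']; exfalso;
  move: h h'; rewrite /lower /upper /outside /=; lra.
Qed.

Lemma piece_nonempty n : exists v, piece n v.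
Proof.
case: n => [|[|n]].
- exists (vec (1 / 6) (1 / 6) (1 / 6)); apply/lower_vec; split; first by split; lra.
  by split; [apply: Qc_diag_lt0; [lra|apply/eqP; lra]|lra].
- exists (vec (1 / 2) (1 / 2) (1 / 2)); apply/upper_vec; split; first by split; lra.
  by split; [apply: Qc_diag_lt0; [lra|apply/eqP; lra]|lra].
- by exists (vec (1 / 2) (1 / 8) (1 / 8)); apply: plane_outside; lra.
Qed.

End Components.

Local Close Scope ring_scope.
Local Open Scope card_scope.

Theorem corollary1 (R : realType) :
  connected (cube R `&` Omega R) /\
  connected_components (cube R `\` Omega R) #= `I_3.
Proof.
split; first exact: connected_Omega.
rewrite card_eq_sym; apply/card_set_bijP; exists (@piece R); split.
- move=> n /= n3; have [v nv] := piece_nonempty R n.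
  by exists v; [exact: piece_sub nv|exact: connected_component_piece].
- move=> n m; rewrite !inE /= => n3 m3 nm.
  have [v nv] := piece_nonempty R n.
  by apply: (piece_disjoint n3 m3 nv); rewrite -nm.
- move=> _ [v Av <-].
  have [h|h|h] := cube_split Av; [exists 0%N|exists 1%N|exists 2%N] => //;
    by apply/esym/connected_component_piece => //; split=> //; case: Av.
Qed.
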